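(* For any fixed number $l$ of commodities, fixed number $m$ of suppliers, and fixed volumes $v_1,\dots,v_l\in\mathbb{Z}_+$, there is an algorithm that, given $n$, supplies and demands $s^i,c^j\in\mathbb{Z}_+^l$ ($1\le i\le m$, $1\le j\le n$), capacities $u_{i,j}\in\mathbb{Z}_+$, and convex costs $f_{i,j},g^j_{i,k}:\mathbb{Z}\to\mathbb{Z}$ presented by evaluation oracles, solves, in time polynomial in $n$ and $\langle s^i,c^j,u,\hat f,\hat g\rangle$, the multicommodity transportation problem $$\min\ \sum_{i,j}\left(f_{i,j}\Big(\sum_{k=1}^l v_kx^j_{i,k}\Big)+\sum_{k=1}^l g^j_{i,k}\big(x^j_{i,k}\big)\right)$$ subject to $$x^j_{i,k}\in\mathbb{Z},\quad \sum_j x^j_{i,k}=s^i_k,\quad \sum_i x^j_{i,k}=c^j_k,\quad \sum_{k=1}^l v_kx^j_{i,k}\le u_{i,j},\quad x^j_{i,k}\ge 0$$ for all $1\le i\le m$, $1\le j\le n$, $1\le k\le l$.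
   Context: The underlying digraph is the complete bipartite digraph $K_{m,n}$ with edges oriented from the $m$ suppliers to the $n$ consumers. $x^j_{i,k}$ is the flow of commodity $k$ from supplier $i$ to consumer $j$; $s^i_k$ is the supply of supplier $i$ in commodity $k$; $c^j_k$ is the consumption of consumer $j$ in commodity $k$; $v_k$ is the volume per unit flow of commodity $k$; $u_{i,j}$ is the capacity of edge $(i,j)$. An evaluation oracle for a function returns its value at any given point. $\hat f$ and $\hat g$ are the maximum absolute values, over the feasible set, of $\sum_{i,j}f_{i,j}(\sum_k v_kx^j_{i,k})$ and $\sum_{i,j}\sum_k g^j_{i,k}(x^j_{i,k})$ respectively (they need not be part of the input). $\langle\cdot\rangle$ denotes binary-encoding length, and $\mathbb{Z}_+$ is the set of nonnegative integers. An algorithm solves an integer programming problem if it either finds an optimal solution or concludes that the feasible set is infinite or empty. *)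

(* Defs.v *)
From mathcomp Require Import all_boot all_order all_algebra.
From mathcomp Require Import boolp classical_sets cardinality.

Set Implicit Arguments.
Unset Strict Implicit.
Unset Printing Implicit Defensive.

Import Order.TTheory GRing.Theory Num.Theory.
Local Open Scope ring_scope.

(** * Oracle random access machine

The model is the unit-cost random access machine whose only arithmetic is
addition and subtraction, written as structured programs.  Since there is no
multiplication, an instruction lengthens the longest number in memory by at
most one bit, so that polynomial time here is polynomial time on a Turing
machine (Cook and Reckhow, 1973).  An oracle call costs one step plus the
evaluation of its arguments, whatever the length of the reply: replies cannot
be charged to [f^] and [g^], which bound only the sums of the costs over the
feasible set and not the individual values [f_ij(z)] and [g_ik^j(z)] (opposite
large constants may be added to two of the functions without changing [f^]). *)

Definition memory := int -> int.

Inductive expr :=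
| Const of int
| Read of expr
| Add of expr & expr
| Sub of expr & expr.

Inductive cmd :=
| Skip
| Store of expr & expr
| Query of expr & seq expr
| Seq of cmd & cmd
| If_le of expr & expr & cmd & cmd
| While_le of expr & expr & cmd.

Fixpoint eval (M : memory) (e : expr) : int :=
  match e with
  | Const z => z
  | Read a => M (eval M a)
  | Add e1 e2 => eval M e1 + eval M e2
  | Sub e1 e2 => eval M e1 - eval M e2
  end.

Fixpoint eval_time (e : expr) : nat :=
  match e with
  | Const _ => 1
  | Read a => (eval_time a).+1
  | Add e1 e2 | Sub e1 e2 => (eval_time e1 + eval_time e2).+1%N
  end.

Definition update (M : memory) (a z : int) : memory :=
  fun b => if b == a then z else M b.

(* [exec O P M M' t]: with oracle [O], the program [P] started in memory [M]
   halts in memory [M'] after [t] steps. *)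
Inductive exec (O : seq int -> int) : cmd -> memory -> memory -> nat -> Prop :=
| ExecSkip M : exec O Skip M M 1
| ExecStore a e M :
    exec O (Store a e) M (update M (eval M a) (eval M e))
      (eval_time a + eval_time e).+1%N
| ExecQuery a q M :
    exec O (Query a q) M (update M (eval M a) (O [seq eval M e | e <- q]))
      (eval_time a + \sum_(e <- q) eval_time e).+1%N
| ExecSeq P1 P2 M M1 M2 t1 t2 :
    exec O P1 M M1 t1 -> exec O P2 M1 M2 t2 ->
    exec O (Seq P1 P2) M M2 (t1 + t2)%N
| ExecIfTrue e1 e2 P1 P2 M M' t :
    eval M e1 <= eval M e2 -> exec O P1 M M' t ->
    exec O (If_le e1 e2 P1 P2) M M' (eval_time e1 + eval_time e2 + t).+1%N
| ExecIfFalse e1 e2 P1 P2 M M' t :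
    eval M e2 < eval M e1 -> exec O P2 M M' t ->
    exec O (If_le e1 e2 P1 P2) M M' (eval_time e1 + eval_time e2 + t).+1%N
| ExecWhileTrue e1 e2 P M M1 M2 t1 t2 :
    eval M e1 <= eval M e2 ->
    exec O P M M1 t1 -> exec O (While_le e1 e2 P) M1 M2 t2 ->
    exec O (While_le e1 e2 P) M M2 (eval_time e1 + eval_time e2 + t1 + t2).+1%N
| ExecWhileFalse e1 e2 P M :
    eval M e2 < eval M e1 ->
    exec O (While_le e1 e2 P) M M (eval_time e1 + eval_time e2).+1%N.

Lemma exec_det O P M M1 M2 t1 t2 :
  exec O P M M1 t1 -> exec O P M M2 t2 -> M1 = M2 /\ t1 = t2.
Proof.
have lele (y z : int) : y <= z -> z < y -> False by move=> h; rewrite ltNge h.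
move=> H; elim: H M2 t2 => {P M M1 t1}; intros;
  match goal with H : exec _ _ _ _ _ |- _ => inversion H; subst end;
  repeat match goal with
  | le : is_true (?y <= ?z), lt : is_true (?z < ?y) |- _ => case: (lele _ _ le lt)
  | IH : (forall _ _, exec _ _ ?M _ _ -> _), E : exec _ _ ?M _ _ |- _ =>
      have [? ?] := IH _ _ E; clear IH; subst
  end; by [].
Qed.

(** * Integer programming *)

(* Convexity inequality at [y], a convex combination of [x] and [z] with
   weights [(z - y) / (z - x)] and [(y - x) / (z - x)]. *)
Definition convex_int (h : int -> int) : Prop :=
  forall x y z : int, x <= y -> y <= z ->
    (z - x) * h y <= (z - y) * h x + (y - x) * h z.

Inductive verdict (T : Type) :=
| Optimal of T
| EmptySet
| InfiniteSet.
Arguments EmptySet {T}.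
Arguments InfiniteSet {T}.

Definition solves (T : Type) (X : set T) (F : T -> int) (o : verdict T) : Prop :=
  match o with
  | Optimal x => X x /\ forall y, X y -> F x <= F y
  | EmptySet => X = set0
  | InfiniteSet => infinite_set X
  end.

(* The maximum of [|F|] over [X]; it is 0 if [X] is empty. *)
Definition max_abs (T : Type) (X : set T) (F : T -> int) : nat :=
  xget 0%N [set h : nat | (exists2 x, X x & `|F x|%N = h) /\
                          forall x, X x -> (`|F x| <= h)%N].

(* Binary length; 0 has length 1. *)
Definition bits (k : nat) : nat := (trunc_log 2 k).+1.

(** * The multicommodity transportation problem

[x i j k] is the flow of commodity [k] from supplier [i] to consumer [j]. *)

Definition flow (m n l : nat) := 'I_m -> 'I_n -> 'I_l -> int.

Section Transportation.
Variables (m n l : nat) (v : 'I_l -> nat).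
Variables (s : 'I_m -> 'I_l -> nat) (c : 'I_n -> 'I_l -> nat).
Variable u : 'I_m -> 'I_n -> nat.
Variable f : 'I_m -> 'I_n -> int -> int.
Variable g : 'I_m -> 'I_n -> 'I_l -> int -> int.

Definition volume (x : flow m n l) (i : 'I_m) (j : 'I_n) : int :=
  \sum_(k < l) (v k)%:Z * x i j k.

Definition feasible : set (flow m n l) :=
  [set x | [/\ forall i k, \sum_(j < n) x i j k = (s i k)%:Z,
               forall j k, \sum_(i < m) x i j k = (c j k)%:Z,
               forall i j, volume x i j <= (u i j)%:Z
             & forall i j k, 0 <= x i j k]].

Definition fcost (x : flow m n l) : int :=
  \sum_(i < m) \sum_(j < n) f i j (volume x i j).

Definition gcost (x : flow m n l) : int :=
  \sum_(i < m) \sum_(j < n) \sum_(k < l) g i j k (x i j k).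

Definition cost (x : flow m n l) : int :=
  \sum_(i < m) \sum_(j < n)
    (f i j (volume x i j) + \sum_(k < l) g i j k (x i j k)).

Definition data_bits : nat :=
  (\sum_(i < m) \sum_(k < l) bits (s i k) +
   \sum_(j < n) \sum_(k < l) bits (c j k) +
   \sum_(i < m) \sum_(j < n) bits (u i j))%N.

(* The input occupies cells 0, 1, 2, ... in the order n, s, c, u, each family
   in row-major order; all other cells, in particular those at negative
   addresses, are 0. *)
Definition input : seq int :=
  n%:Z :: [seq (s i k)%:Z | i <- enum 'I_m, k <- enum 'I_l]
       ++ [seq (c j k)%:Z | j <- enum 'I_n, k <- enum 'I_l]
       ++ [seq (u i j)%:Z | i <- enum 'I_m, j <- enum 'I_n].

Definition initial_memory : memory :=
  fun a => if a is Posz p then nth 0 input p else 0.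

(* Query [i; j; z] returns f_ij(z), and [i; j; k; z] returns g_ik^j(z), with
   indices counted from 0; any other query returns 0. *)
Definition cost_oracle (q : seq int) : int :=
  match q with
  | [:: Posz i; Posz j; z] =>
      if (insub i, insub j) is (Some i', Some j') then f i' j' z else 0
  | [:: Posz i; Posz j; Posz k; z] =>
      if (insub i, insub j, insub k) is (Some i', Some j', Some k')
      then g i' j' k' z else 0
  | _ => 0
  end.

End Transportation.

(* Cell 0 of the final memory holds the verdict; for verdict 0 the optimal flow
   follows from cell 1 on, in row-major order of (i, j, k). *)
Definition output (m n l : nat) (M : memory) : verdict (flow m n l) :=
  if M 0 == 0 then Optimal (fun (i : 'I_m) (j : 'I_n) (k : 'I_l) =>
                          M ((i * n + j) * l + k).+1%N%:Z)
  else if M 0 == 1 then EmptySet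
  else InfiniteSet.

(* Main.v *)
Require Import Defs.
From mathcomp Require Import all_boot all_order all_algebra.
From mathcomp Require Import boolp classical_sets cardinality.
From mathcomp Require Import zify ring.

(** The algorithm improves a flow by best steps.  The difference of two flows
    with the same margins has zero margins; regard it as a family of small
    matrices (bricks), one for each consumer.  By Dickson's lemma, used once for
    the bricks and once for the multisets of bricks that sum to zero, there is a
    finite list of multisets of bricks, which depends on the numbers of
    suppliers and commodities and on the volumes only, such that every nonzero
    difference [d] dominates conformally (no flow or volume changes sign or
    grows) a multiset of the list placed suitably at the consumers
    ([small_moves]).  The number of such moves is polynomial in [n].

    A convex function [K] satisfies
    [K (x + g) + K (x + (d - g)) <= K x + K (x + d)] when [g] is conformally
    below [d].  Hence, if [y] is better than [x], peeling off from [y - x] the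
    largest multiple [2 ^ e * g] of a move again and again shows that some step
    [2 ^ e * g] from [x] gains at least a fraction [1 / p] of [K x - K y], where
    [p] is the number of pairs of a move and an exponent ([best_step]).  The
    same inequality, applied to the violation of the constraints, shows that
    the step stays feasible.  The best of all steps is found by exhaustive
    search, so that [p] rounds halve the distance to the optimum and the number
    of rounds is polynomial in [p] and the binary length of that distance
    ([rounds_lt], [rounds_le]).

    A feasible flow is found in the same way: if supplies and demands balance,
    there is an obvious flow with the right margins but perhaps with negative
    entries and overloaded edges ([start]), and the sum of all these violations
    is a convex function whose minimum over flows with the right margins is 0
    exactly when the problem is feasible.  Its initial value bounds the
    entries of all flows that have to be considered ([margins_bounded]), hence
    the exponents [e].

    The steps within a round are programmed with loops over the consumers only
    and compiled to the machine, which proves at once that they take time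
    polynomial in [n] ([comp_correct]). *)

Set Implicit Arguments.
Unset Strict Implicit.
Unset Printing Implicit Defensive.

Import Order.TTheory GRing.Theory Num.Theory.
Local Open Scope ring_scope.

(** * Minimal elements of sets of tuples of naturals *)

Section Dickson.
Local Open Scope nat_scope.

(** Dickson's lemma, for the componentwise order on the coordinates [s]:
    induction on [s].  Elements whose first coordinate is at least the maximum
    [N] of that coordinate on a basis for the other coordinates need nothing
    new, and each of the values below [N] gets a basis of its own. *)
Lemma dickson (I : eqType) (T : eqType) (phi : I -> T -> nat) (s : seq I)
    (P : T -> Prop) :
  exists L : seq T, (forall q, q \in L -> P q) /\
    forall p, P p -> exists2 q, q \in L & forall i, i \in s -> phi i q <= phi i p.
Proof.
elim: s P => [|i s IHs] P.
  have [[p Pp]|noP] := EM (exists p, P p).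
    exists [:: p]; split=> [q|p' _]; first by rewrite inE => /eqP->.
    by exists p => //; rewrite inE.
  by exists [::]; split=> // p Pp; case: noP; exists p.
have [L [LP domL]] := IHs P.
pose N := \max_(q <- L) phi i q.
have [L' [L'P domL']] : exists L' : seq T, (forall q, q \in L' -> P q) /\
    forall p, P p -> phi i p < N ->
    exists2 q, q \in L' & forall j, j \in i :: s -> phi j q <= phi j p.
  elim: N => [|N [L1 [L1P domL1]]]; first by exists [::]; split.
  have [L2 [L2P domL2]] := IHs (fun p => P p /\ phi i p = N).
  exists (L1 ++ L2); split=> [q|p Pp].
    by rewrite mem_cat => /orP[/L1P|/L2P[]].
  rewrite ltnS leq_eqVlt => /orP[/eqP pN|ltpN].
    have [q qL2 leq] := domL2 p (conj Pp pN).
    exists q => [|j]; first by rewrite mem_cat qL2 orbT.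
    by rewrite inE => /orP[/eqP->|/leq//]; rewrite pN (L2P q qL2).2.
  by have [q qL1 leq] := domL1 p Pp ltpN; exists q; rewrite // mem_cat qL1.
exists (L ++ L'); split=> [q|p Pp].
  by rewrite mem_cat => /orP[/LP|/L'P].
have [ltpN|leNp] := ltnP (phi i p) N.
  by have [q qL' leq] := domL' p Pp ltpN; exists q; rewrite // mem_cat qL' orbT.
have [q qL leq] := domL p Pp; exists q => [|j]; first by rewrite mem_cat qL.
rewrite inE => /orP[/eqP->|/leq//]; apply: leq_trans leNp.
by rewrite /N; apply: (leq_bigmax_seq (F := phi i)).
Qed.

Lemma finite_minimal (I : finType) (P : {ffun I -> nat} -> Prop) :
  exists L : seq {ffun I -> nat}, (forall q, q \in L -> P q) /\
    forall p, P p -> exists2 q, q \in L & forall i, q i <= p i.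
Proof.
have [L [LP dom]] := dickson (fun i (p : {ffun I -> nat}) => p i) (enum I) P.
exists L; split=> // p /dom[q qL leq].
by exists q => // i; apply: leq; rewrite mem_enum.
Qed.

(** A submonoid of [nat ^ I] that is closed under differences is generated by
    its minimal nonzero elements: subtract one as long as possible. *)
Lemma finite_generators (I : finType) (P : {ffun I -> nat} -> Prop) :
  (forall p q, P p -> P q -> (forall i, q i <= p i) ->
     P [ffun i => p i - q i]) ->
  exists A (h : 'I_A -> {ffun I -> nat}),
    (forall a, P (h a) /\ exists i, 0 < h a i) /\
    forall p, P p -> exists lam : 'I_A -> nat,
      forall i, p i = \sum_(a < A) lam a * h a i.
Proof.
move=> subP.
have [L [LP dom]] := finite_minimal (fun p => P p /\ exists i, 0 < p i).
exists (size L), (tnth (in_tuple L)); split=> [a|p Pp]; first exact/LP/mem_tnth.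
have [k] := ubnP (\sum_i p i); elim: k p Pp => // k IHk p Pp ltk.
have [[i p_gt0]|p0] := EM (exists i, 0 < p i); last first.
  exists (fun=> 0) => i; rewrite big1 //.
  by case: (posnP (p i)) => // p_gt0; case: p0; exists i.
have [q qL leq] := dom p (conj Pp (ex_intro _ i p_gt0)).
have [Pq [i0 q_gt0]] := LP q qL.
have [|lam def_lam] := IHk _ (subP _ _ Pp Pq leq).
  rewrite -ltnS (leq_trans _ ltk) // ltnS.
  rewrite (bigD1 i0) //= [ltnRHS](bigD1 i0) //= ffunE.
  rewrite -addSn leq_add //; last by apply: leq_sum => j _; rewrite ffunE leq_subr.
  by rewrite -subSn // leq_subLR addnC -addn1 leq_add2l.
have /tnthP[a0 def_q] : q \in in_tuple L by [].
exists (fun a => lam a + (a == a0)) => j.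
under eq_bigr do rewrite mulnDl.
rewrite big_split /= -def_lam ffunE (bigD1 a0) //= eqxx mul1n -def_q.
rewrite big1 => [|a /negPf->]; last by rewrite mul0n.
by rewrite addn0 subnK.
Qed.

End Dickson.

(** * Small moves *)

(** A flow [x i j k] is handled as the family [X j i k] of its [m * l] bricks,
    one for each consumer, so that flows form an additive group and all
    consumers look alike. *)
Definition bricks (m n l : nat) := {ffun 'I_n -> 'M[int]_(m, l)}.

Definition flow_of m n l (X : bricks m n l) : flow m n l := fun i j k => X j i k.

(** The conformal order of the integers. *)
Definition within (a b : int) := (0 <= a <= b) || (b <= a <= 0).

Section Moves.
Variables (m l : nat) (v : 'I_l -> nat).
Local Notation brick := 'M[int]_(m, l).

Definition brick_volume (b : brick) (i : 'I_m) : int :=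
  \sum_(k < l) (v k)%:Z * b i k.

Lemma brick_volumeD b1 b2 i :
  brick_volume (b1 + b2) i = brick_volume b1 i + brick_volume b2 i.
Proof. by rewrite -big_split /=; apply: eq_bigr => k _; rewrite mxE mulrDr. Qed.

Lemma brick_volumeN b i : brick_volume (- b) i = - brick_volume b i.
Proof. by rewrite -sumrN; apply: eq_bigr => k _; rewrite mxE mulrN. Qed.

Lemma brick_volume0 i : brick_volume 0 i = 0.
Proof. by rewrite /brick_volume big1 // => k _; rewrite mxE mulr0. Qed.

Lemma brick_volumeMn b a i : brick_volume (b *+ a) i = brick_volume b i *+ a.
Proof.
elim: a => [|a IHa]; first by rewrite !mulr0n brick_volume0.
by rewrite !mulrS brick_volumeD IHa.
Qed.

Section FixedConsumers.
Variable n : nat.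
Implicit Types d e g : bricks m n l.

Definition balanced d :=
  (forall i k, \sum_j d j i k = 0) /\ (forall j k, \sum_i d j i k = 0).

(** The conformal order of flows; volumes are compared as well because costs
    and capacities depend on them. *)
Definition below g d : bool :=
  [forall j, forall i, within (brick_volume (g j) i) (brick_volume (d j) i) &&
                       [forall k, within (g j i k) (d j i k)]].

Lemma belowP g d :
  reflect (forall j i, within (brick_volume (g j) i) (brick_volume (d j) i) /\
                       forall k, within (g j i k) (d j i k))
          (below g d).
Proof.
apply: (iffP forallP) => [le_gd j i|le_gd j].
  by have /forallP/(_ i)/andP[? /forallP] := le_gd j.
apply/forallP => i; have [-> ?] := le_gd j i; exact/forallP.
Qed.

Definition single (j : 'I_n) (b : brick) : bricks m n l :=
  [ffun j' => if j' == j then b else 0].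

Fixpoint places (hs : seq brick) : seq (bricks m n l) :=
  if hs is h :: hs' then [seq single j h + g | j <- enum 'I_n, g <- places hs']
  else [:: 0].

Lemma size_places hs : size (places hs) = (n ^ size hs)%N.
Proof. by elim: hs => //= h hs IHhs; rewrite size_allpairs IHhs size_enum_ord expnS. Qed.

Lemma sum_single j b : \sum_j' single j b j' = b.
Proof.
rewrite (bigD1 j) //= ffunE eqxx big1 ?addr0 // => j' /negPf ne.
by rewrite ffunE ne.
Qed.

Lemma sum_places hs g : g \in places hs -> \sum_j g j = \sum_(h <- hs) h.
Proof.
elim: hs g => [|h hs IHhs] g /=.
  by rewrite inE big_nil => /eqP->; rewrite big1 // => j _; rewrite ffunE.
case/allpairsP => -[j g'] /= [_ /IHhs g'P ->].
rewrite big_cons -g'P -[X in _ = X + _](sum_single j) -big_split /=.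
by apply: eq_bigr => j' _; rewrite ffunE.
Qed.

Lemma balanced_places hs g :
  \sum_(h <- hs) h = 0 -> (forall h : brick, h \in hs -> forall k, \sum_i h i k = 0) ->
  g \in places hs -> balanced g.
Proof.
move=> sum_hs col_hs g_hs; split=> [i k|].
  by have /matrixP/(_ i k) := sum_places g_hs; rewrite sum_hs summxE mxE.
elim: hs g g_hs col_hs {sum_hs} => [|h hs IHhs] g /=.
  by rewrite inE => /eqP-> _ j k; rewrite big1 // => i _; rewrite ffunE mxE.
case/allpairsP => -[j' g'] /= [_ g'P ->] col_hs j k.
under eq_bigr do rewrite !ffunE mxE.
rewrite big_split /= IHhs // => [|h' h'P k'].
  case: (j == j'); last by rewrite big1 // => i _; rewrite mxE.
  by rewrite col_hs ?addr0 ?mem_head.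
by rewrite col_hs // inE h'P orbT.
Qed.

(** The bricks are put down one after the other, each at a consumer that still
    has a copy of it left in [Lam]. *)
Lemma distribute A (b : 'I_A -> brick) (hs : seq 'I_A) (Lam : 'I_n -> 'I_A -> nat) :
  (forall a, count_mem a hs <= \sum_j Lam j a)%N ->
  exists Mu : 'I_n -> 'I_A -> nat,
    [/\ forall j a, (Mu j a <= Lam j a)%N,
        forall a, (\sum_j Mu j a = count_mem a hs)%N
      & [ffun j => \sum_a b a *+ Mu j a] \in places (map b hs)].
Proof.
elim: hs Lam => [|a hs IHhs] Lam le_hs /=.
  exists (fun _ _ => 0%N); split=> // [a|]; first by rewrite big1.
  rewrite inE; apply/eqP/ffunP => j; rewrite !ffunE.
  by rewrite big1 // => a _; rewrite mulr0n.
have [j ltj] : exists j, (0 < Lam j a)%N.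
  apply/existsP; apply: contraTT (le_hs a) => /existsPn Lam0.
  rewrite /= eqxx big1 // => j _.
  by apply/eqP; rewrite -leqn0 leqNgt Lam0.
pose del j' a' := ((j' == j) && (a' == a) : nat).
have le_del j' a' : (del j' a' <= Lam j' a')%N.
  by rewrite /del; case: eqP => //= ->; case: eqP => //= ->.
have sum_del a' : (\sum_j' del j' a' = (a == a'))%N.
  rewrite (bigD1 j) //= big1 => [|j' /negPf ne]; last by rewrite /del ne.
  by rewrite /del eqxx addn0 eq_sym.
have [|Mu [le_Mu sum_Mu Mu_hs]] := IHhs (fun j' a' => Lam j' a' - del j' a')%N.
  move=> a'; rewrite sumnB //.
  by rewrite sum_del leq_subRL ?le_hs //; apply: leq_trans (le_hs a'); rewrite leq_addr.
exists (fun j' a' => (del j' a' + Mu j' a')%N); split=> [j' a'|a'|].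
- by rewrite -leq_subRL ?le_Mu.
- by rewrite big_split /= sum_del sum_Mu.
apply/allpairsP; exists (j, [ffun j' => \sum_a' b a' *+ Mu j' a']).
rewrite mem_enum; split=> //; apply/ffunP => j'; rewrite !ffunE /=.
under eq_bigr do rewrite mulrnDr.
rewrite big_split /=; congr (_ + _); rewrite (bigD1 a) //= big1 => [|a' /negPf ne].
  by rewrite /del eqxx andbT addr0; case: (j' == j).
by rewrite /del ne andbF.
Qed.

End FixedConsumers.

End Moves.

Section SmallMoves.
Variables (m l : nat) (v : 'I_l -> nat).
Local Notation brick := 'M[int]_(m, l).
Local Notation coord_index := ('I_m * 'I_l + 'I_m)%type.
Local Notation part_vector := {ffun coord_index * bool -> nat}.

Definition coord (b : brick) (x : coord_index) : int :=
  match x with inl p => b p.1 p.2 | inr i => brick_volume v b i end.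

Lemma coord0 x : coord 0 x = 0.
Proof. by case: x => [p|i] /=; rewrite ?mxE ?brick_volume0. Qed.

Lemma coordB b1 b2 x : coord (b1 - b2) x = coord b1 x - coord b2 x.
Proof. by case: x => [p|i] /=; rewrite ?mxE ?brick_volumeD ?brick_volumeN. Qed.

Lemma coord_sum A (b : 'I_A -> brick) (lam : 'I_A -> nat) x :
  coord (\sum_a b a *+ lam a) x = \sum_a coord (b a) x *+ lam a.
Proof.
have coordD b1 b2 : coord (b1 + b2) x = coord b1 x + coord b2 x.
  by case: (x) => [p|i] /=; rewrite ?mxE ?brick_volumeD.
rewrite (big_morph _ coordD (coord0 x)); apply: eq_bigr => a _.
by case: x {coordD} => [p|i] /=; rewrite ?mulmxnE ?brick_volumeMn.
Qed.

Definition signed_part (s : bool) (z : int) : nat :=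
  if (0 <= z) == s then `|z|%N else 0%N.

Definition parts (b : brick) : part_vector :=
  [ffun x => signed_part x.2 (coord b x.1)].

Definition value (p : part_vector) (x : coord_index) : int :=
  (p (x, true))%:Z - (p (x, false))%:Z.

Lemma value_parts b x : value (parts b) x = coord b x.
Proof. by rewrite /value !ffunE /signed_part /=; case: (coord b x) => k /=; lia. Qed.

Lemma value_sum A (h : 'I_A -> part_vector) (lam : 'I_A -> nat)
    (p : part_vector) x :
  (forall y, p y = \sum_a lam a * h a y)%N ->
  value p x = \sum_a value (h a) x *+ lam a.
Proof.
move=> def_p; rewrite /value !def_p -!natz !natr_sum -sumrB.
by apply: eq_bigr => a _; rewrite !natrM -!natz -mulr_natl; ring.
Qed.

(** The order on parts is the conformal order on bricks. *)
Lemma within_parts b (p : part_vector) x :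
  (forall y, p y <= parts b y)%N -> within (value p x) (coord b x).
Proof.
move=> le_p; have := le_p (x, true); have := le_p (x, false).
rewrite /value /within !ffunE /signed_part /=.
by case: (coord b x) => k /=; lia.
Qed.

Lemma value_eq0 b (p : part_vector) x s :
  (forall y, p y <= parts b y)%N -> value p x = 0 -> p (x, s) = 0%N.
Proof.
move=> le_p; have := le_p (x, true); have := le_p (x, false).
rewrite /value !ffunE /signed_part /=.
by case: s; case: (coord b x) => k /=; lia.
Qed.

Definition expand A (mu : 'I_A -> nat) : seq 'I_A :=
  flatten [seq nseq (mu a) a | a <- enum 'I_A].

Lemma count_expand A (mu : 'I_A -> nat) a : count_mem a (expand mu) = mu a.
Proof.
rewrite count_flatten -map_comp sumnE big_map big_enum /= (bigD1 a) //=.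
rewrite count_nseq /= eqxx mul1n big1 ?addn0 // => a' /negPf ne.
by rewrite count_nseq /= ne.
Qed.

Lemma sum_expand A (mu : 'I_A -> nat) (b : 'I_A -> brick) :
  \sum_(h <- map b (expand mu)) h = \sum_a b a *+ mu a.
Proof.
rewrite big_map big_flatten big_map big_enum; apply: eq_bigr => a _.
by rewrite big_nseq iter_addr addr0.
Qed.

(** Two applications of Dickson's lemma.  A brick with zero column sums,
    together with its volumes, is a conformal sum of bricks [b a] from a finite
    set.  A balanced flow thus places a multiset of the [b a] with sum zero,
    which contains one of finitely many nonempty minimal such multisets; its
    elements, wherever they are placed, form the move.  Their number does not
    depend on the number of consumers. *)
Lemma small_moves : exists HS : seq (seq brick),
  (forall hs, hs \in HS -> \sum_(h <- hs) h = 0 /\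
     forall h : brick, h \in hs -> forall k, \sum_i h i k = 0) /\
  forall n (d : bricks m n l), balanced d -> d != 0 ->
    exists2 hs, hs \in HS &
    exists2 g, g \in places n hs & (g != 0) && below v g d.
Proof.
pose P (p : part_vector) := exists b : brick, (forall k, \sum_i b i k = 0) /\
  forall x, value p x = coord b x.
have [|A [h [hP gen]]] := @finite_generators _ P.
  move=> p q [b [b0 pb]] [c [c0 qc]] le_qp; exists (b - c); split=> [k|x].
    under eq_bigr do rewrite !mxE.
    by rewrite sumrB b0 c0 subrr.
  rewrite coordB -pb -qc /value !ffunE.
  by rewrite -!subzn ?le_qp //; ring.
have {hP} /choice[b /all_and2[/all_and2[b0 hb] h_neq0]] :
    forall a, exists b : brick, ((forall k, \sum_i b i k = 0) /\
      forall x, value (h a) x = coord b x) /\ exists x, (0 < h a x)%N.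
  by move=> a; have [[c cP] ha] := hP a; exists c.
have [L [LP dom]] := finite_minimal (fun mu : {ffun 'I_A -> nat} =>
  \sum_a b a *+ mu a = 0 /\ exists a, (0 < mu a)%N).
exists [seq map b (expand mu) | mu : {ffun 'I_A -> nat} <- L]; split.
  move=> _ /mapP[mu /LP[mu0 _] ->]; split; first by rewrite sum_expand.
  by move=> _ /mapP[a _ ->].
move=> n d [drow dcol] d_neq0.
have /choice[Lam def_Lam] : forall j, exists lam : 'I_A -> nat,
    forall x, parts (d j) x = (\sum_a lam a * h a x)%N.
  by move=> j; apply: gen; exists (d j); split=> // x; apply: value_parts.
have def_d j : d j = \sum_a b a *+ Lam j a.
  apply/matrixP => i k; have := value_parts (d j) (inl (i, k)) => /= <-.
  rewrite (value_sum _ (def_Lam j)) -[RHS]/(coord _ (inl (i, k))) coord_sum.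
  by apply: eq_bigr => a _; rewrite hb.
pose mu : {ffun 'I_A -> nat} := [ffun a => \sum_j Lam j a]%N.
have [] := dom mu.
  split.
    under eq_bigr do rewrite ffunE -sumrMnr.
    rewrite exchange_big /=; under eq_bigr do rewrite -def_d.
    by apply/matrixP => i k; rewrite summxE drow mxE.
  apply/existsP; apply: contraR d_neq0 => /existsPn mu0.
  apply/eqP/ffunP => j; rewrite ffunE def_d big1 // => a _.
  have := mu0 a; rewrite -leqNgt leqn0 ffunE sum_nat_eq0 => /forallP/(_ j)/eqP->.
  by rewrite mulr0n.
move=> tau tauL le_tau; have [tau0 [a0 tau_gt0]] := LP tau tauL.
have [|Mu [le_Mu sum_Mu Mu_places]] := @distribute m l n A b (expand tau) Lam.
  by move=> a; have := le_tau a; rewrite count_expand ffunE.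
exists (map b (expand tau)); first exact: map_f.
exists [ffun j => \sum_a b a *+ Mu j a] => //.
pose p j : part_vector := [ffun x => \sum_a Mu j a * h a x]%N.
have le_p j x : (p j x <= parts (d j) x)%N.
  by rewrite ffunE def_Lam leq_sum // => a _; rewrite leq_mul2r le_Mu orbT.
have def_p j x : value (p j) x = coord (\sum_a b a *+ Mu j a) x.
  rewrite (value_sum (h := h) (lam := Mu j)) => [|y]; last by rewrite ffunE.
  by rewrite coord_sum; apply: eq_bigr => a _; rewrite hb.
apply/andP; split; last first.
  apply/belowP => j i; rewrite ffunE; split=> [|k].
    by have := within_parts (inr i) (le_p j); rewrite def_p.
  by have := within_parts (inl (i, k)) (le_p j); rewrite def_p.
apply/eqP => g0; have [j Mu_gt0] : exists j, (0 < Mu j a0)%N.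
  apply/existsP; apply: contraLR tau_gt0 => /existsPn Mu0.
  rewrite -leqNgt leqn0 -(count_expand tau) -sum_Mu sum_nat_eq0.
  by apply/forallP => j; rewrite -leqn0 leqNgt Mu0.
have [[x s] h_gt0] := h_neq0 a0.
suff : p j (x, s) = 0%N.
  rewrite ffunE (bigD1 a0) //= => /eqP; rewrite addn_eq0 muln_eq0.
  by rewrite !eqn0Ngt Mu_gt0 h_gt0.
apply: value_eq0 (le_p j) _; rewrite def_p.
by move/ffunP: g0 => /(_ j); rewrite !ffunE => ->; rewrite coord0.
Qed.

End SmallMoves.

(** * Best steps *)

Lemma within_sub a b : within a b -> within (b - a) b.
Proof. by rewrite /within; lia. Qed.

Lemma within_trans b a c : within a b -> within b c -> within a c.
Proof. by rewrite /within; lia. Qed.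

Lemma within_double a b : within a b -> within a (b - a) -> within (a + a) b.
Proof. by rewrite /within; lia. Qed.

Lemma convex_exchange (h : int -> int) z a b :
  convex_int h -> within a b -> h (z + a) + h (z + (b - a)) <= h z + h (z + b).
Proof.
suff pos (y p q : int) : convex_int h -> 0 <= p -> 0 <= q ->
    h (y + p) + h (y + q) <= h y + h (y + p + q).
  move=> cvx /orP[/andP[a_ge0 le_ab]|/andP[le_ba a_le0]].
    have := @pos z a (b - a) cvx a_ge0; rewrite subr_ge0 => /(_ le_ab).
    by have -> : z + a + (b - a) = z + b by ring.
  have := @pos (z + b) (a - b) (- a) cvx; rewrite subr_ge0 oppr_ge0.
  move=> /(_ le_ba a_le0).
  have -> : z + b + (a - b) = z + a by ring.
  have -> : z + b - a = z + (b - a) by ring.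
  have -> : z + a - a = z by ring.
  lia.
move=> cvx p_ge0 q_ge0; have [pq0|pq_gt0] := leP (p + q) 0.
  have -> : p = 0 by lia.
  have -> : q = 0 by lia.
  by rewrite !addr0.
have := cvx y (y + p) (y + p + q) ltac:(lia) ltac:(lia).
have := cvx y (y + q) (y + p + q) ltac:(lia) ltac:(lia).
move=> le_q le_p; rewrite -(ler_pM2l pq_gt0).
have -> : (p + q) * (h (y + p) + h (y + q)) =
  (y + p + q - y) * h (y + p) + (y + p + q - y) * h (y + q) by ring.
apply: le_trans (lerD le_p le_q) _.
by rewrite le_eqVlt; apply/orP; left; apply/eqP; ring.
Qed.

Section BestStep.
Variables (m n l : nat) (v : 'I_l -> nat).
Implicit Types x y d g : bricks m n l.
Local Notation below := (below v).

(** The form in which convexity enters the analysis of the steps, both for the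
    objective and for the function whose zero set is the feasible region. *)
Definition superadditive (K : bricks m n l -> int) :=
  forall x g d, below g d -> K (x + g) + K (x + (d - g)) <= K x + K (x + d).

Lemma volume_flow_of x i j : volume v (flow_of x) i j = brick_volume v (x j) i.
Proof. by []. Qed.

Lemma superadditive_cost (f : 'I_m -> 'I_n -> int -> int)
    (g : 'I_m -> 'I_n -> 'I_l -> int -> int) :
  (forall i j, convex_int (f i j)) -> (forall i j k, convex_int (g i j k)) ->
  superadditive (fun x => cost v f g (flow_of x)).
Proof.
move=> cvx_f cvx_g x e d /belowP le_ed.
rewrite /cost -!big_split /=; apply: ler_sum => i _.
rewrite -!big_split /=; apply: ler_sum => j _.
have [le_vol le_flow] := le_ed j i.
rewrite !volume_flow_of !ffunE !brick_volumeD brick_volumeN.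
rewrite addrACA [leRHS]addrACA lerD ?convex_exchange //.
rewrite -!big_split /=; apply: ler_sum => k _.
by rewrite /flow_of !ffunE !mxE convex_exchange.
Qed.

Lemma below_sub g d : below g d -> below (d - g) d.
Proof.
move/belowP => le_gd; apply/belowP => j i; have [le_v le_f] := le_gd j i.
rewrite !ffunE brick_volumeD brick_volumeN; split=> [|k].
  exact: within_sub.
by rewrite !mxE within_sub.
Qed.

Lemma below_trans d e g : below g d -> below d e -> below g e.
Proof.
move=> /belowP gd /belowP de; apply/belowP => j i.
have [gdv gdf] := gd j i; have [dev def] := de j i; split=> [|k].
  exact: within_trans gdv dev.
exact: within_trans (gdf k) (def k).
Qed.

Lemma below_double d g : below g d -> below g (d - g) -> below (g + g) d.
Proof.
move=> /belowP gd /belowP gdg; apply/belowP => j i.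
have [gdv gdf] := gd j i; have [] := gdg j i.
rewrite !ffunE !brick_volumeD brick_volumeN => gdgv gdgf; split=> [|k].
  exact: within_double.
by have := gdgf k; rewrite !mxE; apply: within_double.
Qed.

Lemma balancedB d g : balanced d -> balanced g -> balanced (d - g).
Proof.
move=> [d1 d2] [g1 g2]; split=> [i k|j k].
  under eq_bigr do rewrite !ffunE !mxE.
  by rewrite sumrB d1 g1 subrr.
under eq_bigr do rewrite !ffunE !mxE.
by rewrite sumrB d2 g2 subrr.
Qed.

Lemma balancedMn g a : balanced g -> balanced (g *+ a).
Proof.
move=> [g1 g2]; split=> [i k|j k].
  under eq_bigr do rewrite ffunMnE mulmxnE.
  by rewrite sumrMnl g1 mul0rn.
under eq_bigr do rewrite ffunMnE mulmxnE.
by rewrite sumrMnl g2 mul0rn.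
Qed.

Lemma count_lt (T : eqType) (a1 a2 : pred T) (s : seq T) (g : T) :
  subpred a1 a2 -> g \in s -> a2 g -> ~~ a1 g -> (count a1 s < count a2 s)%N.
Proof.
move=> sub gs a2g a1g; elim: s gs => //= h s IHs.
rewrite inE => /orP[/eqP<-|/IHs lt_s].
  by rewrite a2g (negPf a1g) add0n add1n ltnS sub_count.
by rewrite -addnS leq_add //; case: (a1 h) (sub h) => // ->.
Qed.

Section Select.
Variables (K D : bricks m n l -> int) (S : seq (bricks m n l)) (Q : nat).
Hypothesis K_super : superadditive K.
Hypothesis D_super : superadditive D.
Hypothesis D_ge0 : forall x, 0 <= D x.

Definition bounded d := forall j i k, (`|d j i k| <= Q)%N.

Hypothesis S_select : forall d, balanced d -> bounded d -> d != 0 ->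
  exists2 g, g \in S &
    [/\ balanced g, g != 0, below g d & ~~ below (g + g) d].

(** Peel off from [d] a move of [S] that can be peeled off only once: no move is
    used twice, hence the gain from [x] to [x + d] is at most the sum of the
    gains of at most [size S] moves, and one of them has its share. *)
Lemma select_step x d : balanced d -> bounded d -> D x = 0 -> D (x + d) = 0 ->
  K (x + d) < K x ->
  exists2 g, g \in S &
    D (x + g) = 0 /\ K x - K (x + d) <= (size S)%:Z * (K x - K (x + g)).
Proof.
move=> bal_d bnd_d Dx Dxd lt_K.
pose avail d' : pred (bricks m n l) := fun g => (g != 0) && below g d'.
suff: forall r d', (count (avail d') S <= r)%N ->
    balanced d' -> bounded d' -> D (x + d') = 0 -> K (x + d') < K x ->
    exists2 g, g \in S &
      D (x + g) = 0 /\ K x - K (x + d') <= r%:Z * (K x - K (x + g)).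
  by apply=> //; apply: count_size.
move=> {d bal_d bnd_d Dxd lt_K}; elim=> [|r IHr] d le_r bal_d bnd_d Dxd lt_K.
  have [|g gS [_ g_neq0 le_gd _]] := S_select bal_d bnd_d.
    by apply: contraTneq lt_K => ->; rewrite addr0 ltxx.
  move: le_r; rewrite leqNgt -has_count => /hasPn/(_ g gS).
  by rewrite /avail g_neq0 le_gd.
have [|g gS [bal_g g_neq0 le_gd nle_ggd]] := S_select bal_d bnd_d.
  by apply: contraTneq lt_K => ->; rewrite addr0 ltxx.
have le_dgd := below_sub le_gd.
have [Dg Ddg] : D (x + g) = 0 /\ D (x + (d - g)) = 0.
  have := D_super x le_gd; have := D_ge0 (x + g); have := D_ge0 (x + (d - g)).
  by rewrite Dx Dxd; lia.
have le_K := K_super x le_gd.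
have [le_share|lt_share] := leP (K x - K (x + d)) (r.+1%:Z * (K x - K (x + g))).
  by exists g.
have lt_Kdg : K (x + (d - g)) < K x.
  rewrite ltNge; apply/negP => le_Kdg.
  suff : (K x - K (x + g)) * 1 <= (K x - K (x + g)) * r.+1%:Z by lia.
  by apply: ler_wpM2l; lia.
have {IHr} [|||g' g'S [Dg' le_g']] := IHr (d - g) _ _ _ Ddg lt_Kdg.
- rewrite -ltnS (leq_trans _ le_r) //; apply: (@count_lt _ _ _ _ g) => //.
  + by move=> h /andP[h_neq0 le_h]; rewrite /avail h_neq0 (below_trans le_h).
  + by rewrite /avail g_neq0.
  by rewrite /avail g_neq0; apply: contra nle_ggd; apply: below_double.
- exact: balancedB.
- move=> j i k; apply: leq_trans (bnd_d j i k).
  by have [_ /(_ k)] := belowP _ _ _ le_dgd j i; rewrite /within; lia.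
exists g' => //; split=> //.
have : r%:Z * (r.+1%:Z * (K x - K (x + g')) - (K x - K (x + d))) > 0.
  have : r.+1%:Z * (K x - K (x + g) + (K x - K (x + (d - g)))) <=
         r.+1%:Z * (K x - K (x + g) + r%:Z * (K x - K (x + g'))).
    by apply: ler_wpM2l => //; rewrite lerD2l.
  have : r.+1%:Z * (K x - K (x + d)) <=
         r.+1%:Z * (K x - K (x + g) + (K x - K (x + (d - g)))).
    by apply: ler_wpM2l => //; lia.
  move: lt_share; rewrite -(addn1 r) PoszD.
  move: (K x - K (x + d)) (K x - K (x + g)) (K x - K (x + g')) => t a b.
  by move: (K x - K (x + (d - g))) => c; nia.
move=> gt0; rewrite -subr_ge0 ltW //.
by apply: contraLR gt0; rewrite -!leNgt => le0; apply: mulr_ge0_le0.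
Qed.
End Select.

Definition moves (HS : seq (seq 'M[int]_(m, l))) : seq (bricks m n l) :=
  flatten [seq places n hs | hs <- HS].

Lemma size_moves HS : size (moves HS) = (\sum_(hs <- HS) n ^ size hs)%N.
Proof.
rewrite size_flatten /shape -map_comp sumnE big_map.
by apply: eq_bigr => hs _; rewrite /= size_places.
Qed.

(** The doubling that makes the number of different steps logarithmic in [Q]:
    of all [2 ^ e * g] below [d], the largest can be peeled off only once. *)
Lemma best_step HS (K D : bricks m n l -> int) (Q : nat) x y :
  (forall hs, hs \in HS -> \sum_(h <- hs) h = 0 /\
     forall h : 'M[int]_(m, l), h \in hs -> forall k, \sum_i h i k = 0) ->
  (forall d, balanced d -> d != 0 ->
    exists2 hs, hs \in HS & exists2 g, g \in places n hs & (g != 0) && below g d) ->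
  superadditive K -> superadditive D -> (forall z, 0 <= D z) ->
  balanced (y - x) -> bounded Q (y - x) -> D x = 0 -> D y = 0 -> K y < K x ->
  exists e g, [/\ (2 ^ e <= Q)%N, g \in moves HS, D (x + g *+ 2 ^ e) = 0 &
    K x - K y <= (bits Q * \sum_(hs <- HS) n ^ size hs)%N%:Z *
                 (K x - K (x + g *+ 2 ^ e))].
Proof.
move=> bal_HS dom_HS K_super D_super D_ge0 bal_yx bnd_yx Dx Dy lt_K.
pose S := [seq g *+ 2 ^ e | e <- iota 0 (bits Q), g <- moves HS].
have Q_gt0 : (0 < Q)%N.
  rewrite lt0n; apply: contraTneq lt_K => Q0; rewrite -leNgt.
  suff -> : y = x by [].
  apply/ffunP => j; apply/matrixP => i k; have := bnd_yx j i k.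
  by rewrite Q0 !ffunE !mxE leqn0 absz_eq0 subr_eq0 => /eqP.
have S_select d : balanced d -> bounded Q d -> d != 0 ->
    exists2 g, g \in S & [/\ balanced g, g != 0, below g d & ~~ below (g + g) d].
  move=> bal_d bnd_d d_neq0.
  have [hs hsP [t t_hs /andP[t_neq0 le_td]]] := dom_HS d bal_d d_neq0.
  have le_pow e : below (t *+ 2 ^ e) d -> (2 ^ e <= Q)%N.
    move=> /belowP le_e.
    have [j [i [k tjik]]] : exists j i k, t j i k != 0.
      apply: contrapT => t0; case/eqP: t_neq0; apply/ffunP => j.
      apply/matrixP => i k; rewrite ffunE mxE; apply/eqP.
      by apply: contrapT => tjik; apply: t0; exists j, i, k; apply/negP.
    apply: leq_trans (bnd_d j i k); have [_ /(_ k)] := le_e j i.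
    rewrite ffunMnE mulmxnE -mulr_natr /within.
    move: (2 ^ e)%N (t j i k) (d j i k) tjik => a b c.
    by nia.
  pose P e := below (t *+ 2 ^ e) d.
  have P0 : exists e, P e by exists 0%N; rewrite /P expn0 mulr1n.
  have P_max e : P e -> (e <= Q)%N.
    by move/le_pow; apply: leq_trans; apply/ltnW/ltn_expl.
  have [e Pe max_e] := ex_maxnP P0 P_max.
  exists (t *+ 2 ^ e).
    apply/allpairsP; exists (e, t); rewrite mem_iota add0n /bits ltnS; split=> //=.
      by apply: trunc_log_max => //; apply: le_pow.
    by apply/flattenP; exists (places n hs); rewrite ?map_f.
  have bal_t : balanced t by have [? ?] := bal_HS hs hsP; apply: balanced_places t_hs.
  split=> //.
  - exact: balancedMn.
  - apply: contra t_neq0 => /eqP t0; apply/eqP/ffunP => j; apply/matrixP => i k.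
    move/ffunP/(_ j)/matrixP/(_ i k): t0; rewrite ffunMnE mulmxnE !ffunE !mxE.
    by move/eqP; rewrite mulrn_eq0 expn_eq0 => /eqP.
  by rewrite -mulrnDr addnn -mul2n -expnS; apply/negP => /max_e; rewrite ltnn.
have [||g gS [Dg le_g]] := select_step K_super D_super D_ge0 S_select bal_yx bnd_yx Dx.
- by rewrite addrC subrK.
- by rewrite addrC subrK.
move: gS le_g Dg => /allpairsP[[e t] [eP tP ->]].
rewrite size_allpairs size_iota size_moves [x + (y - x)]addrC subrK => le_g Dg.
exists e, t; split=> //; move: eP; rewrite mem_iota add0n /bits ltnS => le_e.
by apply: leq_trans (trunc_logP (isT : (1 < 2)%N) Q_gt0); rewrite leq_pexp2l.
Qed.

End BestStep.

(** * Number of rounds *)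

(** [rounds p D] decreases whenever [D] loses a fraction [1 / p] of its value:
    while the binary length of [D] is constant, the losses come in units of
    [2 ^ k / p] where [2 ^ k <= D < 2 ^ k.+1]; the successor makes it decrease
    also when [D] becomes shorter or zero. *)
Definition rounds (p D : nat) : nat :=
  if D is 0 then 0%N else
  (p * trunc_log 2 D + (p * (D - 2 ^ trunc_log 2 D)) %/ 2 ^ trunc_log 2 D).+1.

Section Rounds.
Local Open Scope nat_scope.

Lemma rounds_lt p D D' :
  0 < D -> D' <= D -> D <= p * (D - D') -> rounds p D' < rounds p D.
Proof.
case: D => // D _ le_D'; case: D' le_D' => // D' le_D' le_p.
rewrite /rounds ltnS.
have /andP[] := trunc_log_bounds (isT : 1 < 2) (isT : 0 < D.+1).
have /andP[] := trunc_log_bounds (isT : 1 < 2) (isT : 0 < D'.+1).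
move: (trunc_log 2 D'.+1) (trunc_log 2 D.+1) => k' k lo' hi' lo hi.
have : k' <= k.
  by rewrite -ltnS -(ltn_exp2l _ _ (isT : 1 < 2)); apply: leq_ltn_trans lo' (leq_ltn_trans le_D' hi).
rewrite leq_eqVlt => /orP[/eqP eq_k|lt_k].
  move: lo' hi'; rewrite {}eq_k => lo' hi'; rewrite -addnS leq_add2l.
  have -> x : (x %/ 2 ^ k).+1 = (x + 2 ^ k) %/ 2 ^ k.
    by rewrite divnDr // divnn expn_gt0 addn1.
  rewrite leq_div2r //.
  have le_pk : 2 ^ k <= p * (D.+1 - D'.+1) by apply: leq_trans lo le_p.
  rewrite !mulnBr; move: le_pk; rewrite mulnBr.
  have : p * D'.+1 <= p * D.+1 by rewrite leq_mul2l le_D' orbT.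
  have : p * 2 ^ k <= p * D'.+1 by rewrite leq_mul2l lo' orbT.
  move: (p * D'.+1) (p * D.+1) (p * 2 ^ k) (2 ^ k) => a b c e; lia.
have p_gt0 : 0 < p by case: p le_p => //; rewrite mul0n.
have lt_div : (p * (D'.+1 - 2 ^ k')) %/ 2 ^ k' < p.
  rewrite ltn_divLR ?expn_gt0 // ltn_pmul2l //.
  by move: hi'; rewrite expnS; lia.
apply: leq_trans (leq_addr _ _).
apply: (@leq_trans (p * k' + p)); first by rewrite ltn_add2l.
by rewrite -mulnSr leq_mul2l lt_k orbT.
Qed.

Lemma rounds_le p D : rounds p D <= (p * bits D).+1.
Proof.
case: D => // D; rewrite /rounds /bits ltnS mulnS addnC leq_add2r.
have /andP[_] := trunc_log_bounds (isT : 1 < 2) (isT : 0 < D.+1).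
move: (trunc_log _ _) => k hi; apply: (@leq_trans ((p * 2 ^ k) %/ 2 ^ k)).
  by rewrite leq_div2r // leq_mul2l; move: hi; rewrite expnS; lia.
by rewrite mulnK ?expn_gt0.
Qed.

End Rounds.

(** * Binary lengths *)

Section BinaryLength.
Local Open Scope nat_scope.

Lemma ltn_bits a : a < 2 ^ bits a.
Proof. exact: trunc_log_ltn. Qed.

Lemma bits_le a b : 0 < b -> a < 2 ^ b -> bits a <= b.
Proof.
case: a => [|a] b_gt0 lt_a; first by rewrite /bits trunc_log0.
rewrite /bits -(ltn_exp2l _ _ (isT : 1 < 2)).
exact: leq_ltn_trans (trunc_logP _ _) lt_a.
Qed.

Lemma leq_bits a b : a <= b -> bits a <= bits b.
Proof. by move=> le_ab; rewrite ltnS leq_trunc_log. Qed.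

(** Because [a + b + 1 <= (a + 1) * (b + 1)]; the exponents may be zero. *)
Lemma addn_lt_expn a b p q : a < 2 ^ p -> b < 2 ^ q -> a + b < 2 ^ (p + q).
Proof.
rewrite expnD => lt_a lt_b; move: (2 ^ p) (2 ^ q) lt_a lt_b => x y; nia.
Qed.

Lemma sum_lt_expn (I : Type) (r : seq I) (a b : I -> nat) :
  (forall i, a i < 2 ^ b i) -> \sum_(i <- r) a i < 2 ^ (\sum_(i <- r) b i).
Proof.
move=> lt_ab; apply: (big_ind2 (fun x y => x < 2 ^ y)) => // x y x' y'.
exact: addn_lt_expn.
Qed.

End BinaryLength.

(** * The excess of a signed flow *)

Lemma Posz_mulrn (a b : nat) : b%:Z *+ a = (a * b)%N%:Z.
Proof. by rewrite -mulr_natl natz PoszM. Qed.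

Definition over (a z : int) : int := if z <= a then 0 else z - a.

Lemma over_ge0 a z : 0 <= over a z.
Proof. by rewrite /over; case: (leP z _); lia. Qed.

Lemma over_eq0 a z : (over a z == 0) = (z <= a).
Proof. by rewrite /over; case: (leP z _) => h; rewrite ?eqxx // subr_eq0 gt_eqF. Qed.

Lemma over_le_norm (a : nat) z : over a z <= `|z|%N.
Proof. by rewrite /over; case: (leP z _); lia. Qed.

Lemma convex_over a : convex_int (over a).
Proof.
move=> x y z xy yz; rewrite /over.
by case: (leP x a); case: (leP y a); case: (leP z a); nia.
Qed.

Lemma convex_over_opp a : convex_int (fun z => over a (- z)).
Proof.
move=> x y z xy yz; rewrite /over.
by case: (leP (- x) a); case: (leP (- y) a); case: (leP (- z) a); nia.
Qed.

Section Excess.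
Variables (m n l : nat) (v : 'I_l -> nat).
Variables (s : 'I_m -> 'I_l -> nat) (c : 'I_n -> 'I_l -> nat).
Variable u : 'I_m -> 'I_n -> nat.
Implicit Types X Y : bricks m n l.

Definition margins X :=
  (forall i k, \sum_j X j i k = (s i k)%:Z) /\
  (forall j k, \sum_i X j i k = (c j k)%:Z).

Definition excess X : int :=
  cost v (fun i j => over (u i j)) (fun i j k z => over 0 (- z)) (flow_of X).

Lemma excess_superadditive : superadditive v excess.
Proof.
apply: superadditive_cost => [i j|i j k]; first exact: convex_over.
exact: convex_over_opp.
Qed.

Lemma excess_ge0 X : 0 <= excess X.
Proof.
apply: sumr_ge0 => i _; apply: sumr_ge0 => j _.
by rewrite addr_ge0 ?over_ge0 // sumr_ge0 // => k _; apply: over_ge0.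
Qed.

Lemma over_le_excess X i j k : over 0 (- X j i k) <= excess X.
Proof.
have ge0 i' j' : 0 <= over (u i' j') (volume v (flow_of X) i' j') +
    \sum_k over 0 (- flow_of X i' j' k).
  by rewrite addr_ge0 ?over_ge0 // sumr_ge0 // => k' _; apply: over_ge0.
rewrite /excess /cost (bigD1 i) //= (bigD1 j) //= (bigD1 k) //= -!addrA.
rewrite addrCA lerDl !addr_ge0 ?over_ge0 //.
- by apply: sumr_ge0 => k' _; apply: over_ge0.
- by apply: sumr_ge0 => j' _.
by apply: sumr_ge0 => i' _; apply: sumr_ge0.
Qed.

Lemma excess_eq0 X :
  excess X = 0 <-> (forall i j, volume v (flow_of X) i j <= (u i j)%:Z) /\
                   (forall i j k, 0 <= X j i k).
Proof.
split=> [X0|[vol_X X_ge0]]; last first.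
  rewrite /excess /cost big1 // => i _; rewrite big1 // => j _.
  rewrite big1 => [|k _]; apply/eqP; rewrite ?addr0 over_eq0 //.
  by rewrite oppr_le0; apply: X_ge0.
split=> [i j|i j k]; last first.
  have := over_le_excess X i j k; rewrite X0 => le0.
  have : over 0 (- X j i k) == 0 by rewrite eq_le le0 over_ge0.
  by rewrite over_eq0 oppr_le0.
rewrite -over_eq0.
have ge0 i' j' : 0 <= over (u i' j') (volume v (flow_of X) i' j') +
    \sum_k over 0 (- flow_of X i' j' k).
  by rewrite addr_ge0 ?over_ge0 // sumr_ge0 // => k' _; apply: over_ge0.
move/eqP: X0; rewrite psumr_eq0 => [/allP/(_ i)|i' _]; last exact: sumr_ge0.
rewrite mem_index_enum => /(_ isT); rewrite psumr_eq0 //= => /allP/(_ j).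
rewrite mem_index_enum => /(_ isT) /=.
rewrite paddr_eq0 => [/andP[]//||]; first exact: over_ge0.
by apply: sumr_ge0 => k _; apply: over_ge0.
Qed.

Lemma feasible_flow_of X :
  feasible v s c u (flow_of X) <-> margins X /\ excess X = 0.
Proof.
split=> [[sX cX uX pX]|[[sX cX] /excess_eq0[uX pX]]]; last by split.
by split; [split|apply/excess_eq0].
Qed.

Lemma flow_ofE (x : flow m n l) : exists X, x = flow_of X.
Proof.
exists [ffun j => \matrix_(i, k) x i j k].
by apply: funext => i; apply: funext => j; apply: funext => k; rewrite /flow_of ffunE mxE.
Qed.

Lemma margins_balanced X Y : margins X -> margins Y -> balanced (Y - X).
Proof.
move=> [sX cX] [sY cY]; split=> [i k|j k].
  under eq_bigr do rewrite !ffunE !mxE.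
  by rewrite sumrB sX sY subrr.
under eq_bigr do rewrite !ffunE !mxE.
by rewrite sumrB cX cY subrr.
Qed.

Lemma margins_add X Y : margins X -> balanced Y -> margins (X + Y).
Proof.
move=> [sX cX] [sY cY]; split=> [i k|j k].
  under eq_bigr do rewrite !ffunE !mxE.
  by rewrite big_split /= sX sY addr0.
under eq_bigr do rewrite !ffunE !mxE.
by rewrite big_split /= cX cY addr0.
Qed.

Definition total_supply : nat := \sum_i \sum_k s i k.
Definition total_demand : nat := \sum_j \sum_k c j k.

Definition commodity_balance :=
  forall k, (\sum_i s i k)%N = (\sum_j c j k)%N.

Lemma margins_commodity_balance X : margins X -> commodity_balance.
Proof.
move=> [sX cX] k; apply/eqP; rewrite -eqz_nat -!natz !natr_sum; apply/eqP.
under eq_bigr do rewrite natz -sX.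
under [RHS]eq_bigr do rewrite natz -cX.
exact: exchange_big.
Qed.

Lemma demand_le_supply j k : commodity_balance -> (c j k <= total_supply)%N.
Proof.
move=> bal; rewrite /total_supply exchange_big /= (bigD1 k) //= bal (bigD1 j) //=.
by rewrite -addnA leq_addr.
Qed.

(** A signed flow with small excess is bounded: the excess bounds its negative
    entries, hence the demands bound its positive entries. *)
Lemma margins_bounded X Y (E0 : nat) : commodity_balance ->
  margins X -> margins Y -> excess X <= E0 -> excess Y <= E0 ->
  bounded (total_supply + m.+1 * E0)%N (Y - X).
Proof.
move=> bal mX mY eX eY j i k.
have bnd Z : margins Z -> excess Z <= E0 ->
    - E0%:Z <= Z j i k <= total_supply%:Z + (m * E0)%N%:Z.
  move=> [sZ cZ] eZ.
  have lo i' : - E0%:Z <= Z j i' k.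
    have := over_le_excess Z i' j k; rewrite /over; case: (leP (- Z j i' k)); lia.
  rewrite lo /= -lerBlDr.
  have -> : Z j i k = (c j k)%:Z - \sum_(i' | i' != i) Z j i' k.
    by rewrite -cZ (bigD1 i) //= addrK.
  have : \sum_(i' < m | i' != i) - E0%:Z <= \sum_(i' < m | i' != i) Z j i' k.
    by apply: ler_sum => i' _; apply: lo.
  rewrite sumr_const -mulr_natl; have := demand_le_supply j k bal.
  have : (#|[pred i' | i' != i]| * E0 <= m * E0)%N.
    by rewrite leq_mul2r -[X in (_ <= X)%N]card_ord max_card orbT.
  rewrite natz mulrN -PoszM.
  by move: (#|_| * E0)%N (m * E0)%N (\sum_(i' | _) _) => a b e; lia.
have := bnd X mX eX; have := bnd Y mY eY; rewrite !ffunE !mxE mulSn.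
by move: (X j i k) (Y j i k) (m * E0)%N => a b e; lia.
Qed.

(** A signed flow to start from: supplier 0 serves all consumers, and consumer
    0 takes the supplies of the others, at the expense of supplier 0. *)
Definition start : bricks m n l := [ffun j => \matrix_(i, k)
  ((if i == 0%N :> nat then (c j k)%:Z else 0) +
   (if j == 0%N :> nat then
      if i == 0%N :> nat then - (\sum_(i' < m | i' != 0%N :> nat) s i' k)%N%:Z
      else (s i k)%:Z
    else 0))].

(** Without consumers, or without suppliers, balance forces all the margins to be
    zero. *)
Lemma margins_start : commodity_balance -> margins start.
Proof.
move=> bal; split=> [i k|j k].
  have [n0|n_gt0] := posnP n.
    have nobody (j : 'I_n) : False by case: j => j; rewrite n0.
    have := bal k; rewrite [RHS]big1 => [/eqP|j]; last by case: (nobody j).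
    rewrite sum_nat_eq0 => /forallP/(_ i)/eqP->.
    by rewrite big1 // => j; case: (nobody j).
  under eq_bigr do rewrite ffunE mxE.
  rewrite big_split /= [X in _ + X](bigD1 (Ordinal n_gt0)) //= [X in _ + (_ + X)]big1.
    case: eqP => [i0|_]; last by rewrite big1 ?add0r ?addr0.
    have := bal k; rewrite (bigD1 i) //= => /(congr1 Posz).
    have -> : (\sum_j (c j k)%:Z = (\sum_j c j k)%N%:Z).
      by rewrite -natz natr_sum; apply: eq_bigr => j _; rewrite natz.
    rewrite (eq_bigl (fun i' : 'I_m => i' != 0%N :> nat)) => [<-|i'].
      by rewrite addr0 PoszD addrK.
    by rewrite -val_eqE /= i0.
  by move=> j; rewrite -val_eqE /= => /negPf->.
have [m0|m_gt0] := posnP m.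
  have nobody (i : 'I_m) : False by case: i => i; rewrite m0.
  have := bal k; rewrite big1 => [/esym/eqP|i]; last by case: (nobody i).
  rewrite sum_nat_eq0 => /forallP/(_ j)/eqP->.
  by rewrite big1 // => i; case: (nobody i).
under eq_bigr do rewrite ffunE mxE.
rewrite big_split /= (bigD1 (Ordinal m_gt0)) //= [X in _ + X + _]big1; last first.
  by move=> i; rewrite -val_eqE /= => /negPf->.
rewrite addr0; case: eqP => _; last by rewrite big1 ?addr0.
rewrite (bigD1 (Ordinal m_gt0)) //=.
rewrite (eq_bigr (fun i => (s i k)%:Z)) => [|i]; last first.
  by rewrite -val_eqE /= => /negPf->.
rewrite (eq_bigl (fun i : 'I_m => i != 0%N :> nat)) //.
rewrite -[X in - X]natz natr_sum.
by under [X in - X + _]eq_bigr do rewrite natz; rewrite addNr addr0.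
Qed.

Lemma start_bounded j i k : (`|start j i k| <= total_demand + total_supply)%N.
Proof.
have le_c : (c j k <= total_demand)%N.
  by rewrite /total_demand (bigD1 j) //= (bigD1 k) //= -addnA leq_addr.
have le_s : (s i k <= total_supply)%N.
  by rewrite /total_supply (bigD1 i) //= (bigD1 k) //= -addnA leq_addr.
have le_ss : (\sum_(i' < m | i' != 0%N :> nat) s i' k <= total_supply)%N.
  rewrite big_mkcond leq_sum // => i' _; case: ifP => // _.
  by rewrite (bigD1 k) //= leq_addr.
rewrite ffunE mxE; move: (\sum_(i' < m | _) _)%N le_ss => a le_a.
by case: eqP; case: eqP => *; lia.
Qed.

Lemma excess_le X (B : nat) : (forall j i k, `|X j i k| <= B)%N ->
  excess X <= (m * (n * ((\sum_k v k + l) * B)))%N%:Z.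
Proof.
move=> le_B; rewrite /excess /cost.
have le_cell i j : over (u i j) (volume v (flow_of X) i j) +
    \sum_k over 0 (- flow_of X i j k) <= ((\sum_k v k + l) * B)%N%:Z.
  rewrite mulnDl PoszD lerD //.
    apply: le_trans (over_le_norm _ _) _; rewrite abszE.
    apply: le_trans (ler_norm_sum _ _ _) _.
    rewrite big_distrl /= -natz natr_sum; apply: ler_sum => k _.
    rewrite normrM natz PoszM ger0_norm // ler_wpM2l //.
    by have := le_B j i k; rewrite /flow_of; lia.
  have -> : (l * B)%N%:Z = \sum_(k < l) B%:Z.
    by rewrite sumr_const card_ord Posz_mulrn.
  apply: ler_sum => k _; apply: le_trans (@over_le_norm 0 _) _.
  by have := le_B j i k; rewrite /flow_of; lia.
apply: (@le_trans _ _ (\sum_(i < m) \sum_(j < n) ((\sum_k v k + l) * B)%N%:Z)).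
  by apply: ler_sum => i _; apply: ler_sum.
by rewrite !sumr_const !card_ord !Posz_mulrn.
Qed.

End Excess.

(** * Size of the instance *)

Lemma max_abs_ge (T : Type) (X : set T) (F : T -> int) x :
  (exists B, forall y, X y -> (`|F y| <= B)%N) -> X x ->
  (`|F x| <= max_abs X F)%N.
Proof.
move=> [B le_B] Xx; rewrite /max_abs.
pose P h := `[< exists2 y, X y & `|F y|%N = h >].
have P0 : exists h, P h by exists `|F x|%N; apply/asboolP; exists x.
have P_max h : P h -> (h <= B)%N by move=> /asboolP[y Xy <-]; apply: le_B.
have [h Ph max_h] := ex_maxnP P0 P_max.
case: xgetP => [h' _ [_]|no_max]; first exact.
case: (no_max h); split; first exact/asboolP.
by move=> y Xy; apply: max_h; apply/asboolP; exists y.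
Qed.

Section Size.
Variables (m n l : nat) (v : 'I_l -> nat).
Variables (s : 'I_m -> 'I_l -> nat) (c : 'I_n -> 'I_l -> nat).
Variable u : 'I_m -> 'I_n -> nat.

(** The feasible set is finite, its points being bounded by the demands. *)
Lemma feasible_bounded (F : flow m n l -> int) :
  exists B, forall x, feasible v s c u x -> (`|F x| <= B)%N.
Proof.
pose N := (total_demand c).+1.
pose decode (t : {ffun 'I_m * 'I_n * 'I_l -> 'I_N}) : flow m n l :=
  fun i j k => (t (i, j, k) : nat)%:Z.
exists (\max_t `|F (decode t)|)%N => x [_ cx _ x_ge0].
have x_lt i j k : (`|x i j k| < N)%N.
  rewrite ltnS; apply: (@leq_trans (c j k)); last first.
    by rewrite /total_demand (bigD1 j) //= (bigD1 k) //= -addnA leq_addr.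
  rewrite -lez_nat -cx gez0_abs // (bigD1 i) //= lerDl.
  by apply: sumr_ge0 => i' _.
suff -> : x = decode [ffun p => Ordinal (x_lt p.1.1 p.1.2 p.2)].
  exact: (leq_bigmax (F := fun t => `|F (decode t)|%N)).
apply: funext => i; apply: funext => j; apply: funext => k.
by rewrite /decode ffunE /= gez0_abs.
Qed.

Lemma max_abs_feasible (F : flow m n l -> int) x :
  feasible v s c u x -> (`|F x| <= max_abs (feasible v s c u) F)%N.
Proof. exact/max_abs_ge/feasible_bounded. Qed.

Lemma costE f g (x : flow m n l) : cost v f g x = fcost v f x + gcost g x.
Proof.
by rewrite /cost /fcost /gcost -big_split; apply: eq_bigr => i _; rewrite -big_split.
Qed.

Lemma total_lt_data_bits :
  (total_demand c + total_supply s < 2 ^ data_bits s c u)%N.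
Proof.
rewrite /data_bits addnC; apply: leq_trans (leq_pexp2l _ (leq_addr _ _)) => //.
by apply: addn_lt_expn; do 2!apply: sum_lt_expn => ?; apply: ltn_bits.
Qed.

End Size.

(** * A language of bounded loops *)

(** The arithmetic of the algorithm is written in a language whose only loop
    visits the consumers in turn.  Its programs have a functional semantics,
    and they halt in time polynomial in [n] once compiled, so that time has to
    be discussed only for the two loops that are written directly for the
    machine. *)
Section Language.
Variables m l : nat.

(** [Cell], [Demand] and [Capacity] refer to the consumer that the innermost
    loop visits, whose number is [Here]. *)
Inductive term :=
| Lit of int
| Reg of nat
| Cell of bool & 'I_m & 'I_l
| Here
| Supply of 'I_m & 'I_l
| Demand of 'I_l
| Capacity of 'I_m
| Plus of term & term
| Minus of term & term.

Inductive prog :=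
| Nop
| SetReg of nat & term
| SetCell of bool & 'I_m & 'I_l & term
| Emit of 'I_m & 'I_l & term
| Ask of nat & seq term
| Then of prog & prog
| IfLe of term & term & prog & prog
| Loop of prog.

(** [front p] is the content of memory cell [p.+1], which belongs to the input,
    later to the output. *)
Record state := State {
  reg : nat -> int;
  cell : bool -> 'I_m -> 'I_l -> nat -> int;
  front : nat -> int
}.

Definition set_reg r z st :=
  State (fun r' => if r' == r then z else reg st r') (cell st) (front st).

Definition set_cell b i k j z st :=
  State (reg st)
    (fun b' i' k' j' => if (b', i', k', j') == (b, i, k, j) then z
                        else cell st b' i' k' j')
    (front st).

Definition set_front p z st :=
  State (reg st) (cell st) (fun p' => if p' == p then z else front st p').

Section Semantics.
Variables (n : nat) (O : seq int -> int).

Fixpoint den (j : nat) (st : state) (a : term) : int :=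
  match a with
  | Lit z => z
  | Reg r => reg st r
  | Cell b i k => cell st b i k j
  | Here => j%:Z
  | Supply i k => front st (i * l + k)%N
  | Demand k => front st (m * l + (j * l + k))%N
  | Capacity i => front st (m * l + (n * l + (i * n + j)))%N
  | Plus a1 a2 => den j st a1 + den j st a2
  | Minus a1 a2 => den j st a1 - den j st a2
  end.

Fixpoint sem (c : prog) (j : nat) (st : state) : state :=
  match c with
  | Nop => st
  | SetReg r a => set_reg r (den j st a) st
  | SetCell b i k a => set_cell b i k j (den j st a) st
  | Emit i k a => set_front ((i * n + j) * l + k)%N (den j st a) st
  | Ask r qs => set_reg r (O [seq den j st a | a <- qs]) st
  | Then c1 c2 => sem c2 j (sem c1 j st)
  | IfLe a1 a2 c1 c2 =>
      if den j st a1 <= den j st a2 then sem c1 j st else sem c2 j st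
  | Loop c => foldl (fun st' j' => sem c j' st') st (iota 0 n)
  end.

End Semantics.

(** Negative memory holds the registers, the loop counters by nesting depth,
    and the cells, at addresses that are distinct modulo 3. *)
Definition reg_addr (r : nat) : int := - (3 * r + 1)%N%:Z.
Definition counter_addr (d : nat) : int := - (3 * d + 2)%N%:Z.
Definition column (b : bool) (i : 'I_m) (k : 'I_l) : 'I_#|{: bool * 'I_m * 'I_l}| :=
  enum_rank (b, i, k).
Definition width := #|{: bool * 'I_m * 'I_l}|.
Definition cell_addr b i k (j : nat) : int :=
  - (3 * (j * width + column b i k) + 3)%N%:Z.

Lemma cell_addr_inj b i k j b' i' k' j' :
  (cell_addr b i k j == cell_addr b' i' k' j') = ((b, i, k, j) == (b', i', k', j')).
Proof.
apply/eqP/eqP => [|[-> -> -> ->] //]; rewrite /cell_addr => /oppr_inj eq3.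
have {eq3} : (j * width + column b i k = j' * width + column b' i' k')%N.
  by move: (j * _ + _)%N (j' * _ + _)%N eq3 => x y; lia.
move: (ltn_ord (column b i k)) (ltn_ord (column b' i' k')).
rewrite -/width => lt lt' eqc.
have w_gt0 : (0 < width)%N by apply: leq_ltn_trans lt.
have eqj : j = j'.
  by have /(congr1 (divn^~ width)) := eqc; rewrite !divnMDl // !divn_small // !addn0.
move: eqc; rewrite eqj => /eqP; rewrite eqn_add2l => /eqP/val_inj/enum_rank_inj.
by case=> -> -> ->.
Qed.

Lemma reg_addr_inj r r' : (reg_addr r == reg_addr r') = (r == r').
Proof. by apply/eqP/eqP => [|-> //]; rewrite /reg_addr; lia. Qed.
Lemma counter_addr_inj d d' : (counter_addr d == counter_addr d') = (d == d').
Proof. by apply/eqP/eqP => [|-> //]; rewrite /counter_addr; lia. Qed.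
Lemma reg_counter r d : (reg_addr r == counter_addr d) = false.
Proof. by apply/eqP; rewrite /reg_addr /counter_addr; lia. Qed.
Lemma reg_cell r b i k j : (reg_addr r == cell_addr b i k j) = false.
Proof. by apply/eqP; rewrite /reg_addr /cell_addr; lia. Qed.
Lemma counter_cell d b i k j : (counter_addr d == cell_addr b i k j) = false.
Proof. by apply/eqP; rewrite /counter_addr /cell_addr; lia. Qed.
Lemma pos_reg (p r : nat) : (p%:Z == reg_addr r) = false.
Proof. by apply/eqP; rewrite /reg_addr; lia. Qed.
Lemma pos_counter (p d : nat) : (p%:Z == counter_addr d) = false.
Proof. by apply/eqP; rewrite /counter_addr; lia. Qed.
Lemma pos_cell (p : nat) b i k j : (p%:Z == cell_addr b i k j) = false.
Proof. by apply/eqP; rewrite /cell_addr; lia. Qed.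

Definition addr_neq := (reg_counter, reg_cell, counter_cell, pos_reg, pos_counter,
  pos_cell, fun r d => etrans (eq_sym _ _) (reg_counter r d),
  fun r b i k j => etrans (eq_sym _ _) (reg_cell r b i k j),
  fun d b i k j => etrans (eq_sym _ _) (counter_cell d b i k j),
  fun p r => etrans (eq_sym _ _) (pos_reg p r),
  fun p d => etrans (eq_sym _ _) (pos_counter p d),
  fun p b i k j => etrans (eq_sym _ _) (pos_cell p b i k j),
  reg_addr_inj, counter_addr_inj, cell_addr_inj).

(** The machine does not multiply. *)
Fixpoint times (a : nat) (e : expr) : expr :=
  if a is a'.+1 then Add e (times a' e) else Const 0.

Lemma eval_times M a e : eval M (times a e) = a%:Z * eval M e.
Proof.
elim: a => [|a IHa] /=; first by rewrite mul0r.
by rewrite IHa -(add1n a) PoszD mulrDl mul1r.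
Qed.

Definition counter d := Read (Const (counter_addr d)).
Definition cell_expr d b i k :=
  Defs.Sub (Const (cell_addr b i k 0)) (times (3 * width) (counter d)).
Definition consumers := Read (Const 0).

Fixpoint comp_term (d : nat) (a : term) : expr :=
  match a with
  | Lit z => Const z
  | Reg r => Read (Const (reg_addr r))
  | Cell b i k => Read (cell_expr d b i k)
  | Here => counter d
  | Supply i k => Read (Const (i * l + k).+1%N%:Z)
  | Demand k => Read (Add (Const (m * l + k).+1%N%:Z) (times l (counter d)))
  | Capacity i => Read (Add (Const (m * l).+1%N%:Z)
      (Add (times (l + i) consumers) (counter d)))
  | Plus a1 a2 => Add (comp_term d a1) (comp_term d a2)
  | Minus a1 a2 => Defs.Sub (comp_term d a1) (comp_term d a2)
  end.

Fixpoint comp (d : nat) (c : prog) : cmd :=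
  match c with
  | Nop => Skip
  | SetReg r a => Store (Const (reg_addr r)) (comp_term d a)
  | SetCell b i k a => Store (cell_expr d b i k) (comp_term d a)
  | Emit i k a =>
      Store (Add (Const k.+1%N%:Z) (times l (Add (times i consumers) (counter d))))
        (comp_term d a)
  | Ask r qs => Query (Const (reg_addr r)) [seq comp_term d a | a <- qs]
  | Then c1 c2 => Seq (comp d c1) (comp d c2)
  | IfLe a1 a2 c1 c2 =>
      If_le (comp_term d a1) (comp_term d a2) (comp d c1) (comp d c2)
  | Loop c =>
      Seq (Store (Const (counter_addr d.+1)) (Const 0))
        (While_le (Add (counter d.+1) (Const 1)) consumers
          (Seq (comp d.+1 c)
            (Store (Const (counter_addr d.+1)) (Add (counter d.+1) (Const 1)))))
  end.

(** The memory [M] represents [st] in the body of [d] nested loops, the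
    innermost of which visits consumer [j]. *)
Record rep (n d j : nat) (M : memory) (st : state) : Prop := Rep {
  rep_n : M 0 = n%:Z;
  rep_counter : M (counter_addr d) = j%:Z;
  rep_reg : forall r, M (reg_addr r) = reg st r;
  rep_cell : forall b i k j', M (cell_addr b i k j') = cell st b i k j';
  rep_front : forall p : nat, M p.+1%:Z = front st p
}.

Section Correctness.
Variable n : nat.

Lemma rep_set_reg d j M st r z :
  rep n d j M st -> rep n d j (update M (reg_addr r) z) (set_reg r z st).
Proof.
by case=> h1 h2 h3 h4 h5; split=> *; rewrite /update ?(pos_reg 0) ?addr_neq //= h3.
Qed.

Lemma rep_set_cell d j M st b i k j' z : rep n d j M st ->
  rep n d j (update M (cell_addr b i k j') z) (set_cell b i k j' z st).
Proof.
by case=> h1 h2 h3 h4 h5; split=> *; rewrite /update ?(pos_cell 0) ?addr_neq //= h4.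
Qed.

Lemma rep_set_front d j M st (p : nat) z : rep n d j M st ->
  rep n d j (update M p.+1%:Z z) (set_front p z st).
Proof.
by case=> h1 h2 h3 h4 h5; split=> *; rewrite /update ?addr_neq //= eqz_nat eqSS h5.
Qed.

Lemma rep_set_counter d j j' M st : rep n d j M st ->
  rep n d.+1 j' (update M (counter_addr d.+1) j'%:Z) st.
Proof.
by case=> h1 h2 h3 h4 h5; split=> *; rewrite /update ?(pos_counter 0) ?addr_neq ?eqxx.
Qed.

Lemma rep_reset_counter d j j' M st : rep n d.+1 j M st ->
  rep n d.+1 j' (update M (counter_addr d.+1) j'%:Z) st.
Proof.
by case=> h1 h2 h3 h4 h5; split=> *; rewrite /update ?(pos_counter 0) ?addr_neq ?eqxx.
Qed.

Lemma eval_cell_expr d j M st b i k : rep n d j M st ->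
  eval M (cell_expr d b i k) = cell_addr b i k j.
Proof.
by case=> _ h2 _ _ _; rewrite /cell_expr /= eval_times /= h2 /cell_addr; lia.
Qed.

Lemma eval_comp_term d j M st a : rep n d j M st ->
  eval M (comp_term d a) = den n j st a.
Proof.
move=> repM; have [h1 h2 h3 h4 h5] := repM.
elim: a => [z|r|b i k||i k|k|i|a1 IH1 a2 IH2|a1 IH1 a2 IH2].
- by [].
- exact: h3.
- by rewrite [RHS]/= -h4 -(eval_cell_expr b i k repM).
- by rewrite /= h2.
- exact: h5.
- by rewrite /= -h5 eval_times /= h2; congr M; lia.
- by rewrite /= -h5 eval_times /= h1 h2; congr M; lia.
- by rewrite /= IH1 IH2.
- by rewrite /= IH1 IH2.
Qed.

Lemma sem_ask d j M st (qs : seq term) : rep n d j M st ->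
  [seq eval M e | e <- [seq comp_term d a | a <- qs]] = [seq den n j st a | a <- qs].
Proof. by move=> repM; rewrite -map_comp; apply: eq_map => a; apply: eval_comp_term. Qed.

Lemma update_counter M p x z : x != counter_addr p ->
  update M x z (counter_addr p) = M (counter_addr p).
Proof. by rewrite /update eq_sym => /negPf->. Qed.

End Correctness.

Lemma poly_add a1 e1 a2 e2 x : (a1 * x.+1 ^ e1 + a2 * x.+1 ^ e2 <=
  (a1 + a2) * x.+1 ^ (e1 + e2))%N.
Proof.
rewrite mulnDl leq_add // leq_mul2l leq_pexp2l ?orbT ?leq_addl //.
exact: leq_addr.
Qed.

(** A program nested in [d] loops leaves the counters up to the [d]-th alone, so
    that a loop runs its body exactly [n] times.  The exponent thus grows by one
    for each nested loop. *)
Lemma comp_correct d (c : prog) : exists a e, forall n O j M st,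
  rep n d j M st -> exists M' t,
    [/\ exec O (comp d c) M M' t, rep n d j M' (sem n O c j st),
        forall p, (p <= d)%N -> M' (counter_addr p) = M (counter_addr p)
      & (t <= a * n.+1 ^ e)%N].
Proof.
elim: c d => [|r a|b i k a|i k a|r qs|c1 IH1 c2 IH2|a1 a2 c1 IH1 c2 IH2|c IH] d /=.
- exists 1%N, 0%N => n O j M st repM; exists M, 1%N.
  by split=> //; constructor.
- pose t := (1 + eval_time (comp_term d a)).+1%N.
  exists t, 0%N => n O j M st repM; eexists; exists t.
  split; [constructor| |move=> p _|by rewrite muln1].
    by rewrite (eval_comp_term _ repM); apply: rep_set_reg.
  by rewrite update_counter ?addr_neq.
- pose t := (eval_time (cell_expr d b i k) + eval_time (comp_term d a)).+1%N.
  exists t, 0%N => n O j M st repM; eexists; exists t.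
  split; [constructor| |move=> p _|by rewrite muln1].
    by rewrite (eval_comp_term _ repM) (eval_cell_expr _ _ _ repM); apply: rep_set_cell.
  by rewrite update_counter // (eval_cell_expr _ _ _ repM) addr_neq.
- set e := Add (Const k.+1%N%:Z) _.
  pose t := (eval_time e + eval_time (comp_term d a)).+1%N.
  exists t, 0%N => n O j M st repM; eexists; exists t.
  have def_e : eval M e = ((i * n + j) * l + k).+1%N%:Z.
    by case: repM => h1 h2 _ _ _; rewrite /= !eval_times /= eval_times /= h1 h2; lia.
  split; [constructor| |move=> p _|by rewrite muln1].
    by rewrite (eval_comp_term _ repM) def_e; apply: rep_set_front.
  by rewrite update_counter // def_e addr_neq.
- pose t := (1 + \sum_(e <- [seq comp_term d a | a <- qs]) eval_time e).+1%N.
  exists t, 0%N => n O j M st repM; eexists; exists t.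
  split; [constructor| |move=> p _|by rewrite muln1].
    by rewrite (sem_ask _ repM); apply: rep_set_reg.
  by rewrite update_counter ?addr_neq.
- have [b1 [e1 H1]] := IH1 d; have [b2 [e2 H2]] := IH2 d.
  exists (b1 + b2)%N, (e1 + e2)%N => n O j M st repM.
  have [M1 [t1 [ex1 rep1 pres1 le1]]] := H1 n O j M st repM.
  have [M2 [t2 [ex2 rep2 pres2 le2]]] := H2 n O j M1 _ rep1.
  exists M2, (t1 + t2)%N; split=> //; first by apply: ExecSeq ex1 ex2.
    by move=> p le_p; rewrite pres2 // pres1.
  by apply: leq_trans (poly_add _ _ _ _ _); apply: leq_add.
- have [b1 [e1 H1]] := IH1 d; have [b2 [e2 H2]] := IH2 d.
  pose b0 := (eval_time (comp_term d a1) + eval_time (comp_term d a2)).+1%N.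
  exists (b0 + (b1 + b2))%N, (0 + (e1 + e2))%N => n O j M st repM.
  have [M1 [t1 [ex1 rep1 pres1 le1]]] := H1 n O j M st repM.
  have [M2 [t2 [ex2 rep2 pres2 le2]]] := H2 n O j M st repM.
  have le12 : (b0 + (t1 + t2) <= (b0 + (b1 + b2)) * n.+1 ^ (0 + (e1 + e2)))%N.
    apply: leq_trans (poly_add _ _ _ _ _); rewrite expn0 muln1 leq_add2l.
    by apply: leq_trans (poly_add _ _ _ _ _); apply: leq_add.
  case: leP => cmp.
    exists M1, (eval_time (comp_term d a1) + eval_time (comp_term d a2) + t1).+1%N.
    split=> //; first by apply: ExecIfTrue ex1; rewrite !(eval_comp_term _ repM).
    by apply: leq_trans le12; rewrite /b0 addSn ltnS addnA leq_addr.
  exists M2, (eval_time (comp_term d a1) + eval_time (comp_term d a2) + t2).+1%N.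
  split=> //; first by apply: ExecIfFalse ex2; rewrite !(eval_comp_term _ repM).
  by apply: leq_trans le12; rewrite /b0 addSn ltnS leq_add2l leq_addl.
have [b [e H]] := IH d.+1.
exists (2 + (7 + (b + 13)))%N, e.+1 => n O j M st repM.
(* The test takes 7 steps and the increment of the counter takes 6. *)
suff loop r : forall q M1 st1, (q + r)%N = n -> rep n d.+1 q M1 st1 ->
    exists M2 t, [/\ exec O (While_le (Add (counter d.+1) (Const 1)) consumers
          (Seq (comp d.+1 c) (Store (Const (counter_addr d.+1))
             (Add (counter d.+1) (Const 1))))) M1 M2 t,
        rep n d.+1 n M2 (foldl (fun st' j' => sem n O c j' st') st1 (iota q r)),
        forall p, (p <= d)%N -> M2 (counter_addr p) = M1 (counter_addr p)
      & (t <= 7 + r * (b * n.+1 ^ e + 13))%N].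
  have [M2 [t [ex2 rep2 pres2 le_t]]] := loop n 0%N _ _ (add0n n) (rep_set_counter 0 repM).
  exists M2, (3 + t)%N; split.
  - apply: ExecSeq ex2; exact: ExecStore.
  - case: rep2 => h1 _ h3 h4 h5; split=> //; rewrite pres2 //.
    rewrite update_counter ?(rep_counter repM) // addr_neq.
    by rewrite neq_ltn ltnSn orbT.
  - move=> p le_p; rewrite pres2 // update_counter // addr_neq.
    by rewrite eq_sym neq_ltn ltnS le_p.
  rewrite expnS; have := expn_gt0 n.+1 e; move: (n.+1 ^ e)%N le_t => x; nia.
elim: r => [|r IHr] q M1 st1 def_q rep1.
  rewrite addn0 in def_q; exists M1, 7%N; split=> //; last by move: rep1; rewrite {1}def_q.
  apply: (@ExecWhileFalse O (Add (counter d.+1) (Const 1)) consumers).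
  by rewrite /= (rep_counter rep1) (rep_n rep1) def_q; lia.
have [M2 [t2 [ex2 rep2 pres2 le2]]] := H n O q M1 st1 rep1.
have [|M3 [t3 [ex3 rep3 pres3 le3]]] := IHr q.+1 _ _ _ (rep_reset_counter q.+1 rep2).
  by rewrite addSnnS.
exists M3, (4 + 2 + (t2 + 6) + t3).+1%N; split=> //.
- apply: (@ExecWhileTrue O (Add (counter d.+1) (Const 1)) consumers _ _ _ _ _ _ _ _ ex3).
    by rewrite /= (rep_counter rep1) (rep_n rep1) -def_q; lia.
  apply: ExecSeq ex2 _.
  have -> : q.+1%:Z = eval M2 (Add (counter d.+1) (Const 1)).
    by rewrite /= (rep_counter rep2); lia.
  exact: ExecStore.
- move=> p le_p; rewrite pres3 // update_counter ?pres2 // ?leqW // addr_neq.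
  by rewrite eq_sym neq_ltn ltnS le_p.
by rewrite mulSn; lia.
Qed.

End Language.

(** * Programs that evaluate and copy flows *)

Section Programs.
Variables m l : nat.
Local Notation term := (term m l).
Local Notation prog := (prog m l).
Local Notation state := (state m l).

Definition each (T : Type) (s : seq T) (c : T -> prog) : prog :=
  foldr (fun t p => Then (c t) p) (Nop m l) s.

Definition plus_all (T : Type) (s : seq T) (a : T -> term) : term :=
  foldr (fun t b => Plus (a t) b) (Lit m l 0) s.

Definition scale (z : int) (a : term) : term :=
  match z with
  | Posz k => iter k (Plus a) (Lit m l 0)
  | Negz k => Minus (Lit m l 0) (iter k.+1 (Plus a) (Lit m l 0))
  end.

Section Lemmas.
Variables (n : nat) (O : seq int -> int).
Local Notation sem := (sem n O).

Lemma sem_each (T : Type) (s : seq T) (c : T -> prog) j st :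
  sem (each s c) j st = foldl (fun st' t => sem (c t) j st') st s.
Proof. by elim: s st => //= t s IHs st; rewrite IHs. Qed.

Lemma den_plus_all (T : Type) (s : seq T) (a : T -> term) j st :
  den n j st (plus_all s a) = \sum_(t <- s) den n j st (a t).
Proof. by elim: s => [|t s IHs] /=; rewrite ?big_nil // big_cons IHs. Qed.

Lemma den_scale z a j st : den n j st (scale z a) = z * den n j st a.
Proof.
have den_iter k : den n j st (iter k (Plus a) (Lit m l 0)) = k%:Z * den n j st a.
  elim: k => [|k IHk] /=; first by rewrite mul0r.
  by rewrite IHk -(add1n k) PoszD mulrDl mul1r.
case: z => k; first exact: den_iter.
by rewrite NegzE mulNr -den_iter -[RHS]sub0r.
Qed.

Lemma loop_ind (c : prog) (P : nat -> state -> Prop) j0 st : P 0%N st ->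
  (forall (j : 'I_n) st', P j st' -> P j.+1 (sem c j st')) -> P n (sem (Loop c) j0 st).
Proof.
move=> P0 PS /=; suff: forall r q st', (q + r)%N = n -> P q st' ->
    P n (foldl (fun st' j' => sem c j' st') st' (iota q r)) by apply.
elim=> [|r IHr] q st' /=; first by rewrite addn0 => ->.
move=> def_n Pq; apply: IHr; first by rewrite addSnnS.
have lt_qn : (q < n)%N by lia.
exact: (PS (Ordinal lt_qn)).
Qed.

(** [local b a]: the values [a p] for the bricks of array [b] may be stored one
    after the other, since none depends on another entry of the brick. *)
Definition local b (a : 'I_m * 'I_l -> term) := forall p j st st',
  reg st' = reg st -> front st' = front st -> cell st' (~~ b) = cell st (~~ b) ->
  cell st' b p.1 p.2 j = cell st b p.1 p.2 j -> den n j st' (a p) = den n j st (a p).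

Definition set_brick b (a : 'I_m * 'I_l -> term) : prog :=
  each (enum {: 'I_m * 'I_l}) (fun p => SetCell b p.1 p.2 (a p)).

Lemma sem_set_brick b a j st : local b a ->
  let st' := sem (set_brick b a) j st in
  [/\ reg st' = reg st, front st' = front st &
      forall b' i k j', cell st' b' i k j' =
        if (b' == b) && (j' == j) then den n j st (a (i, k)) else cell st b' i k j'].
Proof.
move=> loc_a /=; rewrite sem_each.
suff: forall s, uniq s -> let st' := foldl
       (fun st' p => sem (SetCell b p.1 p.2 (a p)) j st') st (rev s) in
    [/\ reg st' = reg st, front st' = front st &
      forall b' i k j', cell st' b' i k j' =
        if [&& b' == b, j' == j & (i, k) \in s] then den n j st (a (i, k))
        else cell st b' i k j'].
  move=> /(_ (rev (enum {: 'I_m * 'I_l}))); rewrite rev_uniq enum_uniq revK.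
  move=> /(_ isT)[-> -> cellE]; split=> // b' i k j'.
  by rewrite cellE mem_rev mem_enum andbT.
elim=> [|[i0 k0] s IHs] /=; first by split=> // b' i k j'; rewrite !andbF.
move=> /andP[ik_s /IHs]; rewrite rev_cons -cats1 foldl_cat /=.
set st1 := foldl _ _ _ => -[reg1 front1 cell1]; split=> // b' i k j'.
rewrite inE -![(_, _) == _]/(eq_op _ _) !xpair_eqE cell1.
have [->|//] := eqVneq b' b; have [->|_] := eqVneq j' j; rewrite ?andbF //= !andbT.
have [[-> ->]|] := eqVneq (i, k) (i0, k0).
  rewrite !eqxx /=. apply: (loc_a (i0, k0) j st st1) => //=; last by rewrite cell1 (negPf ik_s) !andbF.
  by apply: funext => i'; apply: funext => k'; apply: funext => j1; rewrite cell1; case: (b).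
by rewrite -[(i, k) == _]/(eq_op _ _) xpair_eqE => /negPf->.
Qed.

Lemma sem_set_bricks b a j0 st : local b a ->
  let st' := sem (Loop (set_brick b a)) j0 st in
  [/\ reg st' = reg st, front st' = front st &
      forall b' i k j', cell st' b' i k j' =
        if (b' == b) && (j' < n)%N then den n j' st (a (i, k)) else cell st b' i k j'].
Proof.
move=> loc_a; apply: (loop_ind (P := fun q st' => [/\ reg st' = reg st,
  front st' = front st & forall b' i k j', cell st' b' i k j' =
    if (b' == b) && (j' < q)%N then den n j' st (a (i, k)) else cell st b' i k j'])).
  by split=> // b' i k j'; rewrite andbF.
move=> j st1 [reg1 front1 cell1].
have [-> -> cell2] := sem_set_brick j st1 loc_a; split=> // b' i k j'.
rewrite cell2 cell1 (ltnS j' j) (leq_eqVlt j' j); have [->|//] := eqVneq b' b.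
have [->|//] := eqVneq j' j => /=; apply: (loc_a (i, k) j st st1) => //=; last first.
  by rewrite cell1 ltnn andbF.
by apply: funext => i'; apply: funext => k'; apply: funext => j1; rewrite cell1; case: (b).
Qed.

Definition view b (st : state) : bricks m n l :=
  [ffun j : 'I_n => \matrix_(i, k) cell st b i k j].

Definition copy b : prog :=
  Loop (set_brick (~~ b) (fun p => Cell b p.1 p.2)).

Lemma sem_copy b j st : let st' := sem (copy b) j st in
  [/\ reg st' = reg st, front st' = front st,
      view b st' = view b st & view (~~ b) st' = view b st].
Proof.
have loc : local (~~ b) (fun p => Cell b p.1 p.2).
  by move=> p j' st1 st2 _ _ /=; rewrite negbK => ->.
move: (sem_set_bricks j st loc); rewrite /copy; set st' := sem _ _ _.
move=> [-> -> cellE]; split=> //; apply/ffunP => j'; apply/matrixP => i k; rewrite !ffunE !mxE cellE.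
  by rewrite -[b in b == _]negbK eqb_negLR negbK; case: (b).
by rewrite eqxx ltn_ord.
Qed.

Definition r_step : nat := 5.

Definition shift (h : 'M[int]_(m, l)) : prog :=
  set_brick false (fun p =>
    Plus (Cell false p.1 p.2) (scale (h p.1 p.2) (Reg m l r_step))).

Lemma sem_shift h (j : 'I_n) st (q : nat) : reg st r_step = q%:Z ->
  let st' := sem (shift h) j st in
  [/\ reg st' = reg st, front st' = front st, view true st' = view true st
    & view false st' = view false st + single j h *+ q].
Proof.
move=> def_q.
have loc : local false (fun p =>
    Plus (Cell false p.1 p.2) (scale (h p.1 p.2) (Reg m l r_step))).
  by move=> p j' st1 st2 eq_reg _ _ eq_cell /=; rewrite !den_scale /= eq_cell eq_reg.
move: (sem_set_brick j st loc); rewrite /shift; set st' := sem _ _ _.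
move=> [-> -> cellE]; split=> //; apply/ffunP => j'; apply/matrixP => i k; rewrite !ffunE !mxE cellE //=.
rewrite ffunMnE mulmxnE ffunE den_scale /= def_q.
have [->|ne] := eqVneq j' j; first by rewrite eqxx -mulr_natr natz.
have /negPf-> : j' != j :> nat by [].
by rewrite mxE mul0rn addr0.
Qed.

End Lemmas.
End Programs.

(** * Input and evaluation *)

Lemma nth_allpairs (S T R : Type) (F : S -> T -> R) x0 y0 z0 (r : seq S) (t : seq T) a b :
  (a < size r)%N -> (b < size t)%N ->
  nth z0 [seq F x y | x <- r, y <- t] (a * size t + b)%N = F (nth x0 r a) (nth y0 t b).
Proof.
elim: r a => // x r IHr [|a] lt_a lt_b; rewrite /= nth_cat size_map.
  by rewrite mul0n add0n lt_b (nth_map y0).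
by rewrite mulSn -addnA ltnNge leq_addr /= addKn; apply: IHr.
Qed.

Section Evaluation.
Variables (m n l : nat) (v : 'I_l -> nat).
Variables (s : 'I_m -> 'I_l -> nat) (c : 'I_n -> 'I_l -> nat).
Variable u : 'I_m -> 'I_n -> nat.
Variable f : 'I_m -> 'I_n -> int -> int.
Variable g : 'I_m -> 'I_n -> 'I_l -> int -> int.
Local Notation term := (term m l).
Local Notation prog := (prog m l).
Local Notation state := (state m l).
Local Notation sem := (sem n (cost_oracle f g)).
Local Notation den := (den n).

Definition instance (p : nat) : int := nth 0 (input s c u) p.+1.

Lemma nth_enum_pairs a b (F : 'I_a -> 'I_b -> int) (i : 'I_a) (j : 'I_b) (r : seq int) :
  nth 0 ([seq F i' j' | i' <- enum 'I_a, j' <- enum 'I_b] ++ r) (i * b + j)%N = F i j.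
Proof.
rewrite nth_cat size_allpairs !size_enum_ord.
rewrite (_ : (_ < a * b)%N = true); last by have := ltn_ord i; have := ltn_ord j; nia.
have := nth_allpairs F i j 0 (r := enum 'I_a) (t := enum 'I_b) (a := i) (b := j).
by rewrite !size_enum_ord !nth_ord_enum; apply.
Qed.

Lemma instance_supply (i : 'I_m) (k : 'I_l) : instance (i * l + k)%N = (s i k)%:Z.
Proof. by rewrite /instance /= nth_enum_pairs. Qed.

Lemma instance_demand (j : 'I_n) (k : 'I_l) :
  instance (m * l + (j * l + k))%N = (c j k)%:Z.
Proof.
rewrite /instance /= nth_cat size_allpairs !size_enum_ord ltnNge leq_addr /=.
by rewrite addKn nth_enum_pairs.
Qed.

Lemma instance_capacity (i : 'I_m) (j : 'I_n) :
  instance (m * l + (n * l + (i * n + j)))%N = (u i j)%:Z.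
Proof.
rewrite /instance /= nth_cat size_allpairs !size_enum_ord ltnNge leq_addr /= addKn.
rewrite nth_cat size_allpairs !size_enum_ord ltnNge leq_addr /= addKn.
by rewrite -[[seq _ | _ <- _, _ <- _]]cats0 nth_enum_pairs.
Qed.

Definition r_excess : nat := 0.
Definition r_cost : nat := 1.
Definition r_reply : nat := 2.

Local Notation cells := (bool -> 'I_m -> 'I_l -> nat -> int).

(** Excess and cost are sums over edges and commodities: programs that add terms
    to the two accumulators compose like the sums. *)
Definition adds (p : prog) (e w : cells -> 'I_n -> int) :=
  forall (j : 'I_n) st, front st = instance -> let st' := sem p j st in
  [/\ front st' = instance, cell st' = cell st,
      reg st' r_excess = reg st r_excess + e (cell st) j,
      reg st' r_cost = reg st r_cost + w (cell st) j &
      forall r, (2 < r)%N -> reg st' r = reg st r].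

Lemma adds_then p1 p2 e1 e2 w1 w2 : adds p1 e1 w1 -> adds p2 e2 w2 ->
  adds (Then p1 p2) (fun C j => e1 C j + e2 C j) (fun C j => w1 C j + w2 C j).
Proof.
move=> H1 H2 j st front_st /=.
have [front1 cell1 ex1 co1 reg1] := H1 j st front_st.
have [-> -> -> -> reg2] := H2 j _ front1; rewrite cell1 ex1 co1 !addrA.
by split=> // r lt_r; rewrite reg2 ?reg1.
Qed.

Lemma adds_each (T : Type) (ts : seq T) (p : T -> prog) e w :
  (forall t, adds (p t) (e t) (w t)) ->
  adds (each ts p) (fun C j => \sum_(t <- ts) e t C j) (fun C j => \sum_(t <- ts) w t C j).
Proof.
move=> H; elim: ts => [|t ts IHts] j st front_st.
  by rewrite !big_nil !addr0; split.
by rewrite !big_cons; apply: (adds_then (H t) IHts j front_st).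
Qed.

Definition add_over (a b : term) : prog :=
  IfLe a b (Nop m l) (SetReg r_excess (Plus (Reg m l r_excess) (Minus a b))).

Lemma adds_over (a b : term) (A : cells -> 'I_n -> int) B :
  (forall (j : 'I_n) st, front st = instance -> den j st a = A (cell st) j) ->
  (forall (j : 'I_n) st, front st = instance -> den j st b = B (cell st) j) ->
  adds (add_over a b) (fun C j => over (B C j) (A C j)) (fun _ _ => 0).
Proof.
move=> aP bP j st front_st; rewrite /over /= (aP j st) // (bP j st) //.
by case: leP => _; rewrite !addr0; split=> //=; case.
Qed.

Definition add_reply (qs : seq term) : prog :=
  Then (Ask r_reply qs) (SetReg r_cost (Plus (Reg m l r_cost) (Reg m l r_reply))).

Lemma adds_reply (qs : seq term) (w : cells -> 'I_n -> int) :
  (forall (j : 'I_n) st, front st = instance ->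
     cost_oracle f g [seq den j st a | a <- qs] = w (cell st) j) ->
  adds (add_reply qs) (fun _ _ => 0) w.
Proof.
move=> qsP j st front_st /=; rewrite addr0 qsP //.
by split=> // -[|[|[]]].
Qed.

Lemma oracle_f (i : 'I_m) (j : 'I_n) z :
  cost_oracle f g [:: (i : nat)%:Z; (j : nat)%:Z; z] = f i j z.
Proof. by case: z => z; rewrite /= !valK. Qed.

Lemma oracle_g (i : 'I_m) (j : 'I_n) (k : 'I_l) z :
  cost_oracle f g [:: (i : nat)%:Z; (j : nat)%:Z; (k : nat)%:Z; z] = g i j k z.
Proof. by rewrite /= !valK. Qed.

Definition volume_term (i : 'I_m) : term :=
  plus_all (enum 'I_l) (fun k => scale (v k)%:Z (Cell false i k)).

Lemma den_volume_term i j st :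
  den j st (volume_term i) = \sum_k (v k)%:Z * cell st false i k j.
Proof.
by rewrite den_plus_all big_enum; apply: eq_bigr => k _; rewrite den_scale.
Qed.

Definition eval_edge (i : 'I_m) : prog :=
  Then (add_over (volume_term i) (Capacity l i))
  (Then (add_reply [:: Lit m l (i : nat)%:Z; Here m l; volume_term i])
  (each (enum 'I_l) (fun k =>
    Then (add_over (Minus (Lit m l 0) (Cell false i k)) (Lit m l 0))
      (add_reply [:: Lit m l (i : nat)%:Z; Here m l; Lit m l (k : nat)%:Z; Cell false i k])))).

Lemma adds_edge i : adds (eval_edge i)
  (fun C j => over (u i j) (\sum_k (v k)%:Z * C false i k j) +
              (0 + \sum_(k <- enum 'I_l) (over 0 (0 - C false i k j) + 0)))
  (fun C j => 0 + (f i j (\sum_k (v k)%:Z * C false i k j) +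
              \sum_(k <- enum 'I_l) (0 + g i j k (C false i k j)))).
Proof.
apply: adds_then.
  apply: adds_over => j st front_st; first exact: den_volume_term.
  by rewrite /= front_st instance_capacity.
apply: adds_then.
  by apply: adds_reply => j st _; rewrite -oracle_f -den_volume_term.
apply: adds_each => k; apply: adds_then; first exact: adds_over.
by apply: adds_reply => j st _; rewrite -oracle_g.
Qed.

Definition evaluate : prog :=
  Then (SetReg r_excess (Lit m l 0)) (Then (SetReg r_cost (Lit m l 0))
    (Loop (each (enum 'I_m) eval_edge))).

Lemma sem_evaluate j st : front st = instance -> let st' := sem evaluate j st in
  [/\ front st' = instance, cell st' = cell st,
      reg st' r_excess = excess v u (view n false st),
      reg st' r_cost = cost v f g (flow_of (view n false st)) &
      forall r, (2 < r)%N -> reg st' r = reg st r].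
Proof.
move=> front_st /=; set st0 := set_reg r_cost 0 _.
pose e i (j : 'I_n) := over (u i j) (volume v (flow_of (view n false st)) i j) +
  \sum_k over 0 (- flow_of (view n false st) i j k).
pose w i (j : 'I_n) := f i j (volume v (flow_of (view n false st)) i j) +
  \sum_k g i j k (flow_of (view n false st) i j k).
have [||front1 cell1 ex1 co1 reg1] := @loop_ind _ _ n (cost_oracle f g)
  (each (enum 'I_m) eval_edge) (fun q st' =>
  [/\ front st' = instance, cell st' = cell st,
    reg st' r_excess = \sum_(j < n | (j < q)%N) \sum_i e i j,
    reg st' r_cost = \sum_(j < n | (j < q)%N) \sum_i w i j &
    forall r, (2 < r)%N -> reg st' r = reg st r]) j st0.
- split=> //; try by rewrite big1.
  by case=> [|[|[]]].
- move=> {}j st' [front' cell' ex' co' reg'].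
  have [front2 cell2 ex2 co2 reg2] := adds_each (enum 'I_m) adds_edge j front'.
  have sumS (F : 'I_n -> int) : \sum_(i < n | (i < j.+1)%N) F i =
      \sum_(i < n | (i < j)%N) F i + F j.
    rewrite (bigD1 j) ?ltnS //= addrC; congr (_ + _); apply: eq_bigl => i.
    by rewrite ltnS ltn_neqAle andbC.
  split=> //; try by rewrite ?cell2 ?cell'.
  + rewrite ex2 ex' sumS cell' big_enum; congr (_ + _); apply: eq_bigr => i _.
    rewrite add0r /e; congr (over _ _ + _).
      by apply: eq_bigr => k _; rewrite /flow_of ffunE mxE.
    by rewrite big_enum; apply: eq_bigr => k _; rewrite addr0 sub0r /flow_of ffunE mxE.
  + rewrite co2 co' sumS cell' big_enum; congr (_ + _); apply: eq_bigr => i _.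
    rewrite add0r /w; congr (f i j _ + _).
      by apply: eq_bigr => k _; rewrite /flow_of ffunE mxE.
    by rewrite big_enum; apply: eq_bigr => k _; rewrite add0r /flow_of ffunE mxE.
  + by move=> r lt_r; rewrite reg2 ?reg'.
have sumn (F : 'I_n -> int) : \sum_(i < n | (i < n)%N) F i = \sum_i F i.
  by apply: eq_bigl => i; rewrite ltn_ord.
by split=> //; rewrite ?ex1 ?co1 sumn exchange_big.
Qed.

End Evaluation.

(** * Search for the best step *)

Section Search.
Variables (m l : nat) (v : 'I_l -> nat).
Local Notation prog := (prog m l).
Local Notation state := (state m l).
Local Notation brick := 'M[int]_(m, l).

Definition r_best : nat := 3.
Definition r_old : nat := 4.
Definition r_bound : nat := 6.

(** In the first phase, the excess is minimized over all signed flows with the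
    right margins; in the second one, the cost is minimized over those without
    excess. *)
Definition violation_term (second : bool) :=
  if second then Reg m l r_excess else Lit m l 0.
Definition objective_term (second : bool) :=
  if second then Reg m l r_cost else Reg m l r_excess.

Definition update_best (second : bool) : prog :=
  Then (evaluate m v)
    (IfLe (violation_term second) (Lit m l 0)
      (IfLe (Plus (objective_term second) (Lit m l 1)) (Reg m l r_best)
        (Then (SetReg r_best (objective_term second)) (copy m l false))
        (Nop m l))
      (Nop m l)).

Fixpoint try_places (second : bool) (hs : seq brick) : prog :=
  if hs is h :: hs' then
    Loop (Then (shift h) (Then (try_places second hs') (shift (- h))))
  else update_best second.

Definition try_moves second (HS : seq (seq brick)) : prog :=
  each HS (try_places second).

Variable n : nat.
Variables (s : 'I_m -> 'I_l -> nat) (c : 'I_n -> 'I_l -> nat).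
Variable u : 'I_m -> 'I_n -> nat.
Variable f : 'I_m -> 'I_n -> int -> int.
Variable g : 'I_m -> 'I_n -> 'I_l -> int -> int.
Local Notation sem := (sem n (cost_oracle f g)).
Local Notation view := (view n).
Local Notation instance := (instance s c u).
Implicit Type X : bricks m n l.

Definition violation (second : bool) X : int := if second then excess v u X else 0.
Definition objective (second : bool) X : int :=
  if second then cost v f g (flow_of X) else excess v u X.

(** Array [true] holds the best flow found so far, array [false] the flow under
    examination. *)
Definition incumbent second (st : state) :=
  [/\ margins s c (view true st), violation second (view true st) = 0
    & reg st r_best = objective second (view true st)].

Definition searched second (st st' : state) (S : seq (bricks m n l)) :=
  [/\ front st' = instance, incumbent second st',
      view false st' = view false st,
      reg st' r_best <= reg st r_best /\ (forall r, (3 < r)%N -> reg st' r = reg st r)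
    & forall d, d \in S -> violation second (view false st + d) = 0 ->
        reg st' r_best <= objective second (view false st + d)].

Lemma sem_update_best second j st :
  front st = instance -> incumbent second st -> margins s c (view false st) ->
  searched second st (sem (update_best second) j st) [:: 0].
Proof.
move=> front_st inc_st mar_st; rewrite /=.
have [front1 cell1 ex1 co1 reg1] := sem_evaluate v f g j front_st.
move: front1 cell1 ex1 co1 reg1; set st1 := foldl _ _ _ => front1 cell1 ex1 co1 reg1.
have viewE b : view b st1 = view b st by apply/ffunP => j'; rewrite !ffunE cell1.
have inc1 : incumbent second st1.
  by case: inc_st => h1 h2 h3; split; rewrite ?viewE // reg1.
have objE : den n j st1 (objective_term second) = objective second (view false st).
  by case: second {inc_st inc1}.
have vioE : den n j st1 (violation_term second) = violation second (view false st).
  by case: second {inc_st inc1 objE}.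
rewrite vioE objE; case: (leP (violation _ _)) => vio; last first.
  split=> //; first by split=> [|r lt_r]; rewrite reg1 // ltnW.
  by move=> d; rewrite inE => /eqP->; rewrite addr0; lia.
case: (leP (objective _ _ + 1)) => obj; last first.
  split=> //; first by split=> [|r lt_r]; rewrite reg1 // ltnW.
  by move=> d; rewrite inE => /eqP->; rewrite addr0; lia.
rewrite reg1 // in obj.
have := sem_copy n (cost_oracle f g) false j (set_reg r_best (objective second (view false st)) st1).
rewrite /=; set st2 := foldl _ _ _; move=> [reg2 front2 view2 view2'].
have view1' z : view false (set_reg r_best z st1) = view false st.
  by rewrite -viewE; apply/ffunP => j'; rewrite !ffunE.
have vio0 : violation second (view false st) = 0.
  apply/eqP; rewrite eq_le vio; case: (second) => //; exact: excess_ge0.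
split; rewrite ?front2 ?view2 ?view1' //.
- by split; rewrite ?view2' ?view1' // reg2.
- split=> [|r lt_r]; rewrite reg2 /=; first by lia.
  by rewrite gtn_eqF // reg1 // ltnW.
by move=> d; rewrite inE => /eqP->; rewrite addr0 reg2.
Qed.

(** Array [false] may be used as working space by all nested loops, because each
    iteration undoes its shift; the margins are right only when all bricks of
    [hs] have been placed, which is where the flow is evaluated. *)
Lemma sem_try_places second hs j st (q : nat) :
  front st = instance -> reg st r_step = q%:Z -> incumbent second st ->
  (forall d, d \in places n hs -> margins s c (view false st + d *+ q)) ->
  searched second st (sem (try_places second hs) j st) [seq d *+ q | d <- places n hs].
Proof.
elim: hs j st => [|h hs IHhs] j st front_st def_q inc_st mar_st.
  rewrite [map _ _]/= mul0rn; apply: sem_update_best => //.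
  by have := mar_st 0; rewrite mul0rn addr0 inE; apply.
pose P a st' := searched second st st'
  [seq (single j' h + d) *+ q | j' <- [seq j' : 'I_n <- enum 'I_n | (j' < a)%N], d <- places n hs].
have [front' inc' view' regs' best'] : P n (sem (try_places second (h :: hs)) j st).
  apply: loop_ind.
    by split=> //= d /allpairsP[[j' d'] [/=]]; rewrite mem_filter.
  move=> {}j st0 [front0 inc0 view0 [best0 reg0] search0].
  rewrite [sem _ _ _]/=.
  have [] := @sem_shift m l n (cost_oracle f g) h j st0 q; first by rewrite reg0.
  rewrite -/(sem (shift h) j st0); set st1 := sem _ _ _.
  move=> reg1 front1 view1 view1'; rewrite view0 in view1'.
  have inc1 : incumbent second st1.
    by case: inc0 => h1 h2 h3; split; rewrite ?view1 // reg1.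
  have [||||front2 inc2 view2 [best2 reg2] search2] := IHhs j st1.
  - by rewrite front1.
  - by rewrite reg1 reg0.
  - by [].
  - move=> d d_hs; rewrite view1' -addrA -mulrnDl; apply: mar_st.
    by apply/allpairsP; exists (j, d); rewrite mem_enum.
  move: front2 inc2 view2 best2 reg2 search2; set st2 := sem _ _ _.
  move=> front2 inc2 view2 best2 reg2 search2.
  have [] := @sem_shift m l n (cost_oracle f g) (- h) j st2 q.
    by rewrite reg2 // reg1 reg0.
  set st3 := sem _ _ _ => reg3 front3 view3 view3'.
  split.
  - by rewrite front3.
  - by case: inc2 => h1 h2 h3; split; rewrite ?view3 // reg3.
  - rewrite view3' view2 view1' -addrA -mulrnDl.
    suff -> : single j h + single j (- h) = 0 by rewrite mul0rn addr0.
    by apply/ffunP => j'; rewrite !ffunE; case: eqP => _; rewrite ?subrr ?addr0.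
  - rewrite reg3; split=> [|r lt_r]; first by rewrite (le_trans best2) // reg1.
    by rewrite reg2 // reg1 reg0.
  move=> d /allpairsP[[j' d'] [/=]]; rewrite mem_filter ltnS leq_eqVlt.
  case/andP=> /orP[/eqP/val_inj-> _ d'P ->|lt_j _ d'P ->] vio; rewrite reg3.
    have := search2 (d' *+ q); rewrite view1' -addrA -mulrnDl; apply=> //.
    exact: map_f.
  apply: le_trans best2 _; rewrite reg1; apply: search0 => //.
  by apply/allpairsP; exists (j', d'); rewrite mem_filter lt_j mem_enum.
split=> // _ /mapP[d /allpairsP[[j' d'] [_ d'P ->] ->]]; apply: best'.
by apply/allpairsP; exists (j', d'); rewrite mem_filter ltn_ord mem_enum.
Qed.

Lemma sem_try_moves second HS j st (q : nat) :
  (forall hs, hs \in HS -> \sum_(h <- hs) h = 0 /\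
     forall h : brick, h \in hs -> forall k, \sum_i h i k = 0) ->
  front st = instance -> reg st r_step = q%:Z -> incumbent second st ->
  margins s c (view false st) ->
  searched second st (sem (try_moves second HS) j st) [seq d *+ q | d <- moves n HS].
Proof.
rewrite sem_each; elim: HS st => [|hs HS IHHS] st bal_HS front_st def_q inc_st mar_st.
  by split.
have [front1 inc1 view1 [best1 reg1] search1] : searched second st
    (sem (try_places second hs) j st) [seq d *+ q | d <- places n hs].
  apply: sem_try_places => // d d_hs; apply: margins_add => //.
  have [sum0 col0] := bal_HS hs (mem_head _ _).
  exact/balancedMn/(balanced_places sum0 col0).
have [|||||front2 inc2 view2 [best2 reg2] search2] := IHHS (sem (try_places second hs) j st).
- by move=> hs' hs'P; apply: bal_HS; rewrite inE hs'P orbT.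
- by [].
- by rewrite reg1.
- by [].
- by rewrite view1.
split=> //; first by rewrite view2.
  by split=> [|r lt_r]; [apply: le_trans best2 best1|rewrite reg2 ?reg1].
move=> _ /mapP[d + ->]; rewrite /moves /= mem_cat => /orP[d_hs|d_HS] vio.
  by apply: le_trans best2 _; apply: search1 => //; apply: map_f.
by have := search2 (d *+ q); rewrite view1; apply=> //; apply: map_f.
Qed.

End Search.

(** * Polynomial bounds *)

Definition poly_bounded (T : nat -> nat) : Prop :=
  exists a e, forall z, (T z <= a * z.+1 ^ e)%N.

Lemma poly_const a : poly_bounded (fun=> a).
Proof. by exists a, 0%N => z; rewrite muln1. Qed.

Lemma poly_id : poly_bounded id.
Proof. by exists 1%N, 1%N => z; rewrite mul1n. Qed.

Lemma poly_addn T1 T2 :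
  poly_bounded T1 -> poly_bounded T2 -> poly_bounded (fun z => T1 z + T2 z)%N.
Proof.
move=> [a1 [e1 H1]] [a2 [e2 H2]]; exists (a1 + a2)%N, (e1 + e2)%N => z.
by apply: leq_trans (poly_add _ _ _ _ _); apply: leq_add.
Qed.

Lemma poly_muln T1 T2 :
  poly_bounded T1 -> poly_bounded T2 -> poly_bounded (fun z => T1 z * T2 z)%N.
Proof.
move=> [a1 [e1 H1]] [a2 [e2 H2]]; exists (a1 * a2)%N, (e1 + e2)%N => z.
by rewrite expnD mulnACA leq_mul.
Qed.

Lemma poly_expn T e : poly_bounded T -> poly_bounded (fun z => T z ^ e)%N.
Proof.
move=> polyT; elim: e => [|e IHe]; first exact: poly_const.
have [a [e' H]] := poly_muln polyT IHe.
by exists a, e' => z; rewrite expnS.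
Qed.

Lemma poly_sum (T : Type) (r : seq T) (F : T -> nat -> nat) :
  (forall t, poly_bounded (F t)) -> poly_bounded (fun z => \sum_(t <- r) F t z)%N.
Proof.
move=> polyF; elim: r => [|t r IHr].
  by exists 0%N, 0%N => z; rewrite big_nil.
have [a [e H]] := poly_addn (polyF t) IHr.
by exists a, e => z; rewrite big_cons.
Qed.

Lemma leq_pow a b e : (a <= b)%N -> (a ^ e <= b ^ e)%N.
Proof. by case: e => // e le_ab; rewrite leq_exp2r. Qed.

(** * Rounds of best steps *)

(** [k] is a variant: it bounds the number of iterations that are left. *)
Lemma run_while m l n O (a b : term m l) body (Inv : nat -> state m l -> Prop) T :
  (forall k M st, rep n 0 0 M st -> Inv k st -> den n 0 st a <= den n 0 st b ->
    exists M' t st' k', [/\ exec O body M M' t, rep n 0 0 M' st', Inv k' st',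
      (k' < k)%N & (t <= T)%N]) ->
  let cmp_time := (eval_time (comp_term 0 a) + eval_time (comp_term 0 b)).+1 in
  forall k M st, rep n 0 0 M st -> Inv k st ->
  exists M' t st' k', [/\ exec O (While_le (comp_term 0 a) (comp_term 0 b) body) M M' t,
    rep n 0 0 M' st', Inv k' st', den n 0 st' b < den n 0 st' a &
    (t <= k * (T + cmp_time) + cmp_time)%N].
Proof.
move=> run_body cmp_time k; have [N] := ubnP k.
elim: N k => // N IHN k; rewrite ltnS => le_kN M st repM Inv_st.
case: (leP (den n 0 st a) (den n 0 st b)) => cmp; last first.
  exists M, cmp_time, st, k; split=> //; last exact: leq_addl.
  by apply: ExecWhileFalse; rewrite !(eval_comp_term _ repM).
have [M1 [t1 [st1 [k1 [ex1 rep1 Inv1 lt_k1 le_t1]]]]] := run_body k M st repM Inv_st cmp.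
have [M2 [t2 [st2 [k2 [ex2 rep2 Inv2 cmp2 le_t2]]]]] :=
  IHN k1 (leq_trans lt_k1 le_kN) M1 st1 rep1 Inv1.
exists M2, (eval_time (comp_term 0 a) + eval_time (comp_term 0 b) + t1 + t2).+1, st2, k2.
split=> //; first by apply: ExecWhileTrue ex1 ex2; rewrite !(eval_comp_term _ repM).
have : (k1.+1 * (T + cmp_time) <= k * (T + cmp_time))%N by rewrite leq_mul2r lt_k1 orbT.
rewrite mulSn /cmp_time in le_t2 *; lia.
Qed.

Section Phase.
Variables (m l : nat) (v : 'I_l -> nat).
Variable HS : seq (seq 'M[int]_(m, l)).
Variable second : bool.

Hypothesis HS_balanced : forall hs, hs \in HS -> \sum_(h <- hs) h = 0 /\
  forall h : 'M[int]_(m, l), h \in hs -> forall k, \sum_i h i k = 0.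
Hypothesis HS_dominates : forall n (d : bricks m n l), balanced d -> d != 0 ->
  exists2 hs, hs \in HS & exists2 g, g \in places n hs & (g != 0) && below v g d.

Definition start_round : prog m l :=
  Then (SetReg r_old (Reg m l r_best)) (Then (copy m l true) (SetReg r_step (Lit m l 1))).

Definition try_and_double : prog m l :=
  Then (try_moves v second HS)
    (SetReg r_step (Plus (Reg m l r_step) (Reg m l r_step))).

Definition phase : cmd :=
  While_le (comp_term 0 (Plus (Reg m l r_best) (Lit m l 1))) (comp_term 0 (Reg m l r_old))
    (Seq (comp 0 start_round)
      (While_le (comp_term 0 (Reg m l r_step)) (comp_term 0 (Reg m l r_bound))
        (comp 0 try_and_double))).

Section Instance.
Variable n : nat.
Variables (s : 'I_m -> 'I_l -> nat) (c : 'I_n -> 'I_l -> nat).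
Variable u : 'I_m -> 'I_n -> nat.
Variable f : 'I_m -> 'I_n -> int -> int.
Variable g : 'I_m -> 'I_n -> 'I_l -> int -> int.
Hypothesis cvx_f : forall i j, convex_int (f i j).
Hypothesis cvx_g : forall i j k, convex_int (g i j k).
Local Notation O := (cost_oracle f g).
Local Notation objective := (objective v u f g second).
Local Notation violation := (violation v u second).
Local Notation incumbent := (incumbent v s c u f g second).
Local Notation margins := (margins s c).
Local Notation instance := (instance s c u).

Lemma objective_superadditive : superadditive v objective.
Proof.
rewrite /objective; case: second; first exact: superadditive_cost.
exact: excess_superadditive.
Qed.

Lemma violation_superadditive : superadditive v violation.
Proof. by rewrite /violation; case: second => //; apply: excess_superadditive. Qed.

Lemma violation_ge0 X : 0 <= violation X.
Proof. by rewrite /violation; case: second => //; apply: excess_ge0. Qed.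

(** Invariant of the loop over the step lengths [2 ^ e <= Q] from the flow [X]. *)
Definition scanned (X : bricks m n l) Q old e (st : state m l) : Prop :=
  [/\ front st = instance, incumbent st, view n false st = X,
      [/\ reg st r_best <= old, reg st r_old = old, reg st r_bound = Q &
          reg st r_step = (2 ^ e)%N%:Z]
    & forall e' d, (e' < e)%N -> d \in moves n HS -> violation (X + d *+ 2 ^ e') = 0 ->
        reg st r_best <= objective (X + d *+ 2 ^ e')].

Lemma scanned_start st : front st = instance -> incumbent st ->
  scanned (view n true st) (reg st r_bound) (reg st r_best) 0 (sem n O start_round 0 st).
Proof.
move=> front_st [mar_st vio_st best_st].
have := sem_copy n O true 0 (set_reg r_old (reg st r_best) st).
set st1 := sem _ _ _ _ _; rewrite -[sem _ _ start_round _ _]/(set_reg r_step 1 st1).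
move: st1 => st1 [reg1 front1 view1 view1'].
have viewE b z st' : view n b (set_reg r_step z st') = view n b st'.
  by apply/ffunP => j; rewrite !ffunE.
have viewE' : view n true (set_reg r_old (reg st r_best) st) = view n true st.
  by apply/ffunP => j; rewrite !ffunE.
split=> //; first by rewrite /= front1.
- by split; rewrite viewE view1 viewE' // /= reg1.
by rewrite /= reg1.
Qed.

Lemma scanned_next X Q old e st : margins X -> scanned X Q old e st ->
  scanned X Q old e.+1 (sem n O try_and_double 0 st).
Proof.
move=> mar_X [front_st inc_st view_st [best_st old_st Q_st step_st] scan_st].
have [] := @sem_try_moves m l v n s c u f g second HS 0 st (2 ^ e)%N HS_balanced.
- by [].
- by [].
- by [].
- by rewrite view_st.
rewrite [sem _ _ try_and_double _ _]/=; set st1 := sem _ _ _ _ _.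
move=> front1 inc1 view1 [best1 reg1] search1.
have viewE b z st' : view n b (set_reg r_step z st') = view n b st'.
  by apply/ffunP => j; rewrite !ffunE.
split=> //.
- by rewrite viewE view1.
- split=> /=; [exact: le_trans best1 best_st | by rewrite reg1 | by rewrite reg1 |].
  by rewrite reg1 // step_st expnS mul2n -addnn PoszD.
move=> e' d; rewrite ltnS leq_eqVlt => /orP[/eqP->|lt_e'] d_HS vio /=.
  by rewrite -view_st; apply: search1; rewrite ?view_st //; apply: map_f.
by apply: le_trans best1 _; apply: scan_st.
Qed.

(** The variant of the loop over the rounds: as long as the optimum is not
    reached, the gap shrinks by a fraction [1 / p]; one more round without
    improvement ends the loop, and the boolean summand accounts for it. *)
Lemma round_progress X (Q : nat) old e st y :
  margins X -> violation X = 0 -> objective X = old ->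
  margins y -> violation y = 0 ->
  (forall z, margins z -> violation z = 0 -> objective y <= objective z) ->
  bounded Q (y - X) -> scanned X Q%:Z old e st -> (Q < 2 ^ e)%N ->
  let p := (bits Q * \sum_(hs <- HS) n ^ size hs)%N in
  let gap z := `|z - objective y|%N in
  (rounds p (gap (reg st r_best)) + (reg st r_best < old)%R < (rounds p (gap old)).+1)%N
  /\ (reg st r_best < old \/ reg st r_best = objective y).
Proof.
move=> mar_X vio_X obj_X mar_y vio_y min_y bnd scan lt_Q p gap.
have [front_st inc_st view_st [best_st old_st Q_st step_st] scan_st] := scan.
have [mar_b vio_b obj_b] := inc_st.
have y_best : objective y <= reg st r_best by rewrite obj_b min_y.
have [lt_y|le_y] := ltP (objective y) old; last first.
  have best_y : reg st r_best = objective y by apply/eqP; rewrite eq_le y_best (le_trans best_st).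
  have old_y : old = objective y by apply/eqP; rewrite eq_le le_y (le_trans y_best).
  by split; [rewrite best_y old_y ltxx addn0 | right].
have lt_K : objective y < objective X by rewrite obj_X.
have [e' [d [le_e' d_HS vio_d gain]]] := best_step HS_balanced (@HS_dominates n)
  objective_superadditive violation_superadditive violation_ge0
  (margins_balanced mar_X mar_y) bnd vio_X vio_y lt_K.
have lt_e' : (e' < e)%N by rewrite -(ltn_exp2l _ _ (isT : (1 < 2)%N)); apply: leq_ltn_trans lt_Q.
have le_best := scan_st e' d lt_e' d_HS vio_d.
rewrite -/p obj_X in gain.
have gap_p : (gap old <= p * (gap old - gap (reg st r_best)))%N.
  rewrite -lez_nat PoszM -subzn; last by rewrite /gap; lia.
  rewrite /gap !gez0_abs ?subr_ge0 ?(ltW lt_y) //.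
  apply: le_trans gain _; rewrite ler_wpM2l //; lia.
have gap_le : (gap (reg st r_best) <= gap old)%N by rewrite /gap; lia.
have gap_gt0 : (0 < gap old)%N by rewrite /gap; lia.
have lt_best : reg st r_best < old.
  have : (gap (reg st r_best) != gap old)%N.
    by apply: contraTneq gap_p => ->; rewrite subnn muln0 -ltnNge.
  by rewrite /gap; lia.
by split; [rewrite lt_best addn1 ltnS; apply: rounds_lt | left].
Qed.

End Instance.

Lemma run_phase : exists T, poly_bounded T /\ forall n
    (s : 'I_m -> 'I_l -> nat) (c : 'I_n -> 'I_l -> nat) (u : 'I_m -> 'I_n -> nat)
    (f : 'I_m -> 'I_n -> int -> int) (g : 'I_m -> 'I_n -> 'I_l -> int -> int)
    M (st : state m l) (Q : nat) y (z : nat),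
  (forall i j, convex_int (f i j)) -> (forall i j k, convex_int (g i j k)) ->
  rep n 0 0 M st -> front st = instance s c u ->
  incumbent v s c u f g second st ->
  reg st r_best < reg st r_old -> reg st r_bound = Q%:Z ->
  margins s c y -> violation v u second y = 0 ->
  (forall x, margins s c x -> violation v u second x = 0 ->
     objective v u f g second y <= objective v u f g second x) ->
  (forall x, margins s c x -> violation v u second x = 0 ->
     objective v u f g second x <= reg st r_best -> bounded Q (y - x)) ->
  (n <= z)%N -> (bits Q <= z)%N ->
  (bits `|reg st r_best - objective v u f g second y| <= z)%N ->
  exists M' t st', [/\ exec (cost_oracle f g) phase M M' t, rep n 0 0 M' st',
    front st' = instance s c u /\ incumbent v s c u f g second st',
    reg st' r_bound = Q%:Z /\ reg st' r_best = objective v u f g second y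
    & (t <= T z)%N].
Proof.
have [a1 [e1 run_start]] := comp_correct 0 start_round.
have [a2 [e2 run_try]] := comp_correct 0 try_and_double.
pose k1 := (eval_time (comp_term 0 (Plus (Reg m l r_best) (Lit m l 1))) +
  eval_time (comp_term 0 (Reg m l r_old))).+1.
pose k2 := (eval_time (comp_term 0 (Reg m l r_step)) +
  eval_time (comp_term 0 (Reg m l r_bound))).+1.
pose T1 z := (a1 * z.+1 ^ e1 + (z * (a2 * z.+1 ^ e2 + k2) + k2))%N.
pose R z := (z * (\sum_(hs <- HS) z ^ size hs) * z + 2)%N.
exists (fun z => R z * (T1 z + k1) + k1)%N; split.
  have polyS : poly_bounded S.
    by have := poly_addn (poly_const 1) poly_id.
  have polyE a e : poly_bounded (fun z => a * z.+1 ^ e)%N.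
    by apply: poly_muln (poly_const _) (poly_expn _ polyS).
  rewrite /R /T1; do ?[exact: poly_const|exact: poly_id|exact: polyE|
    apply: poly_addn|apply: poly_muln|apply: poly_sum => ?|apply: poly_expn].
move=> n s c u f g M st Q y z cvx_f cvx_g repM front_st inc_st lt_old Q_st.
move=> mar_y vio_y min_y bnd_y le_nz le_Qz le_gz.
pose p := (bits Q * \sum_(hs <- HS) n ^ size hs)%N.
pose gap x := `|x - objective v u f g second y|%N.
pose Inv k (st' : state m l) :=
  [/\ front st' = instance s c u, incumbent v s c u f g second st',
    reg st' r_best <= reg st r_best /\ reg st' r_bound = Q,
    k = (rounds p (gap (reg st' r_best)) + (reg st' r_best < reg st' r_old)%R)%N &
    (reg st' r_best < reg st' r_old) \/ reg st' r_best = objective v u f g second y].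
have Inv_st : Inv (rounds p (gap (reg st r_best)) + 1)%N st.
  by split=> //; [rewrite lt_old | left].
have le_expz a e : (a * n.+1 ^ e <= a * z.+1 ^ e)%N.
  by rewrite leq_mul2l leq_pow ?orbT.
have [|M' [t [st' [k' [ex' rep' Inv' cmp' le_t]]]]] := @run_while m l n
    (cost_oracle f g) (Plus (Reg m l r_best) (Lit m l 1)) (Reg m l r_old)
    (Seq (comp 0 start_round)
      (While_le (comp_term 0 (Reg m l r_step)) (comp_term 0 (Reg m l r_bound))
        (comp 0 try_and_double))) Inv (T1 z) _ _ _ _ repM Inv_st; last first.
  exists M', t, st'; have [front' inc' [best' bound'] _ opt'] := Inv'.
  split=> //.
    split=> //; case: opt' => // lt'; move: cmp'; rewrite /=; lia.
  apply: leq_trans le_t _; rewrite -/k1 leq_add2r leq_mul2r addn1; apply/orP; right.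
  rewrite /R addn2 ltnS; apply: leq_trans (rounds_le _ _) _.
  rewrite ltnS leq_mul // leq_mul // leq_sum // => hs _.
  exact: leq_pow.
move=> k M1 st1 rep1 [front1 inc1 [best1 bound1] def_k _] cmp.
have lt_old1 : reg st1 r_best < reg st1 r_old by move: cmp; rewrite /=; lia.
have [M2 [t2 [ex2 rep2 _ le_t2]]] := run_start n (cost_oracle f g) 0%N M1 st1 rep1.
have [mar1 vio1 obj1] := inc1.
pose Inv2 r st' := exists e, (r + e)%N = bits Q /\
  scanned s c u f g (view n true st1) Q (reg st1 r_best) e st'.
have Inv2_start : Inv2 (bits Q) (sem n (cost_oracle f g) start_round 0 st1).
  by exists 0%N; rewrite addn0 -bound1; split=> //; apply: scanned_start.
have [|M3 [t3 [st3 [r3 [ex3 rep3 [e3 [_ scan3]] cmp3 le_t3]]]]] := @run_while m l n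
    (cost_oracle f g) (Reg m l r_step) (Reg m l r_bound) (comp 0 try_and_double) Inv2 (a2 * n.+1 ^ e2)%N _ _ _ _
    rep2 Inv2_start.
  move=> r M4 st4 rep4 [e4 [def_r scan4]] cmp4.
  have [M5 [t5 [ex5 rep5 _ le_t5]]] := run_try n (cost_oracle f g) 0%N M4 st4 rep4.
  exists M5, t5, (sem n (cost_oracle f g) try_and_double 0 st4), r.-1; split=> //.
    exists e4.+1; split; last exact: scanned_next.
    have : (e4 < bits Q)%N.
      rewrite ltnS trunc_log_max // -lez_nat.
      by have [_ _ _ [_ _ <- <-] _] := scan4.
    by move: def_r; lia.
  have : (e4 < bits Q)%N.
    rewrite ltnS trunc_log_max // -lez_nat.
    by have [_ _ _ [_ _ <- <-] _] := scan4.
  by move: def_r; lia.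
have lt_Q : (Q < 2 ^ e3)%N.
  by have [_ _ _ [_ _ Q3 step3] _] := scan3; move: cmp3; rewrite /= Q3 step3.
have bnd1 : bounded Q (y - view n true st1) by apply: bnd_y; rewrite // -obj1.
have [lt_rounds opt3] := round_progress cvx_f cvx_g mar1 vio1 (esym obj1) mar_y vio_y
  min_y bnd1 scan3 lt_Q.
have [front3 inc3 _ [best3 old3 bound3 _] _] := scan3.
exists M3, (t2 + t3)%N, st3.
exists (rounds p (gap (reg st3 r_best)) + (reg st3 r_best < reg st3 r_old)%R)%N; split=> //.
- exact: ExecSeq ex2 ex3.
- split=> //; first by rewrite (le_trans best3).
  by rewrite old3; exact: opt3.
- by rewrite def_k lt_old1 addn1 old3; apply: lt_rounds.
apply: leq_add; first exact: leq_trans le_t2 (le_expz _ _).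
apply: leq_trans le_t3 _; rewrite -/k2 leq_add2r leq_mul // leq_add2r.
exact: le_expz.
Qed.

End Phase.

(** * Initialization and output *)

Section Setup.
Variables (m l : nat) (v : 'I_l -> nat).
Local Notation prog := (prog m l).
Local Notation state := (state m l).

Definition r_unbalanced : nat := 7.

Definition check_commodity (k : 'I_l) : prog :=
  Then (SetReg r_reply (plus_all (enum 'I_m) (fun i => Supply i k)))
  (Then (Loop (SetReg r_reply (Minus (Reg m l r_reply) (Demand m k))))
  (Then (IfLe (Reg m l r_reply) (Lit m l 0) (Nop m l) (SetReg r_unbalanced (Lit m l 1)))
        (IfLe (Lit m l 0) (Reg m l r_reply) (Nop m l) (SetReg r_unbalanced (Lit m l 1))))).

Definition start_demands : prog :=
  Loop (set_brick true (fun p => if p.1 == 0%N :> nat then Demand m p.2 else Lit m l 0)).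

Definition other_supplies (k : 'I_l) :=
  plus_all [seq i : 'I_m <- enum 'I_m | i != 0%N :> nat] (fun i => Supply i k).

(** Outside all loops, the current consumer is consumer 0. *)
Definition start_supplies : prog :=
  set_brick true (fun p => Plus (Cell true p.1 p.2)
    (if p.1 == 0%N :> nat then Minus (Lit m l 0) (other_supplies p.2)
     else Supply p.1 p.2)).

Definition reset_best (second : bool) : prog :=
  Then (copy m l true) (Then (evaluate m v)
  (Then (SetReg r_best (objective_term m l second))
        (SetReg r_old (Plus (Reg m l r_best) (Lit m l 1))))).

Definition set_bound : prog :=
  SetReg r_bound (Plus (plus_all (enum 'I_m) (fun i => plus_all (enum 'I_l) (Supply i)))
    (scale m.+1 (Reg m l r_best))).

Definition check_balance : prog := each (enum 'I_l) check_commodity.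

Definition prepare : prog :=
  Then start_demands (Then start_supplies (Then (reset_best false) set_bound)).

Definition emit_flow : prog :=
  Loop (each (enum {: 'I_m * 'I_l}) (fun p => Emit p.1 p.2 (Cell true p.1 p.2))).

Variable n : nat.
Variables (s : 'I_m -> 'I_l -> nat) (c : 'I_n -> 'I_l -> nat).
Variable u : 'I_m -> 'I_n -> nat.
Variable f : 'I_m -> 'I_n -> int -> int.
Variable g : 'I_m -> 'I_n -> 'I_l -> int -> int.
Local Notation sem := (sem n (cost_oracle f g)).
Local Notation view := (view n).
Local Notation instance := (instance s c u).

Lemma sem_check_commodity k j st : front st = instance ->
  let st' := sem (check_commodity k) j st in front st' = instance /\
  reg st' r_unbalanced =
    if (\sum_i s i k == \sum_j c j k)%N then reg st r_unbalanced else 1.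
Proof.
move=> front_st; rewrite [sem _ _ _]/=; set st0 := set_reg _ _ st.
have [] := @loop_ind _ _ n (cost_oracle f g)
  (SetReg r_reply (Minus (Reg m l r_reply) (Demand m k)))
  (fun q st' => [/\ front st' = instance, reg st' r_unbalanced = reg st r_unbalanced &
    reg st' r_reply = (\sum_i s i k)%N%:Z - (\sum_(j < n | (j < q)%N) c j k)%N%:Z]) j st0.
- split=> //; rewrite [X in _ - Posz X]big_pred0 // subr0 /=.
  rewrite den_plus_all big_enum -[RHS]natz natr_sum.
  by apply: eq_bigr => i _; rewrite /= front_st instance_supply natz.
- move=> j' st' [front' unb' reply']; split=> //=.
  rewrite reply' front' instance_demand [in RHS](bigD1 j') ?ltnS //=.
  rewrite [in RHS](eq_bigl (fun i : 'I_n => (i < j')%N)) => [|i].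
    by rewrite PoszD; ring.
  by rewrite ltnS ltn_neqAle andbC.
rewrite [sem _ _ _]/=; set st1 := foldl _ _ _ => front1 unb1.
have -> : (\sum_(i < n | (i < n)%N) c i k = \sum_i c i k)%N.
  by apply: eq_bigl => i; rewrite ltn_ord.
move=> reply1.
have eq_reply : (\sum_i s i k == \sum_j c j k)%N = (reg st1 r_reply == 0).
  by rewrite reply1 subr_eq0 eqz_nat.
rewrite eq_reply /=; move: (unb1) front1 => {reply1 eq_reply}.
case: (ltgtP (reg st1 r_reply) 0) => sgn /=.
- by rewrite (leNgt 0) sgn.
- by rewrite (ltW sgn).
by rewrite sgn lexx.
Qed.

Lemma sem_check_balance j st : front st = instance -> reg st r_unbalanced = 0 ->
  let st' := sem check_balance j st in front st' = instance /\
  (reg st' r_unbalanced <= 0 <-> commodity_balance s c).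
Proof.
move=> front_st unb_st; rewrite sem_each.
suff: forall ks st0, front st0 = instance ->
    let st' := foldl (fun st' k => sem (check_commodity k) j st') st0 ks in
    front st' = instance /\ reg st' r_unbalanced =
    if all (fun k => \sum_i s i k == \sum_j c j k)%N ks then reg st0 r_unbalanced else 1.
  move=> /(_ (enum 'I_l) st front_st)[front' unb'] st'; split; first exact: front'.
  have -> : reg st' r_unbalanced = _ := unb'; rewrite unb_st.
  case: allP => bal; split=> //.
    by move=> _ k; apply/eqP/bal; rewrite mem_enum.
  by move=> balk; case: bal => k _; apply/eqP/balk.
elim=> [|k ks IHks] st0 front0 //=.
have [front1 unb1] := sem_check_commodity k j front0.
have [-> ->] := IHks _ front1; split=> //; rewrite unb1.
by case: eqP => _ //=; case: all.
Qed.

Lemma sem_start st : front st = instance ->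
  let st' := sem start_supplies 0 (sem start_demands 0 st) in
  [/\ front st' = instance, reg st' = reg st & view true st' = start s c].
Proof.
move=> front_st.
pose a1 (p : 'I_m * 'I_l) := if p.1 == 0%N :> nat then Demand m p.2 else Lit m l 0.
have loc1 : local n true a1.
  move=> p j st1 st2 _ eq_front _ _; rewrite /a1.
  by case: ifP => _ //=; rewrite eq_front.
pose a2 (p : 'I_m * 'I_l) := Plus (Cell true p.1 p.2)
  (if p.1 == 0%N :> nat then Minus (Lit m l 0) (other_supplies p.2)
   else Supply p.1 p.2).
have den_other k j st1 : front st1 = instance ->
    den n j st1 (other_supplies k) = (\sum_(i < m | i != 0%N :> nat) s i k)%N%:Z.
  move=> front1; rewrite den_plus_all big_filter big_enum_cond -[RHS]natz natr_sum.
  by apply: eq_bigr => i _; rewrite /= front1 instance_supply natz.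
have loc2 : local n true a2.
  move=> p j st1 st2 _ eq_front _ eq_cell; rewrite /a2 /= eq_cell; congr (_ + _).
  case: ifP => _ /=; rewrite ?eq_front //; congr (_ - _).
  by rewrite !den_plus_all; apply: eq_bigr => i _; rewrite /= eq_front.
have [reg1 front1 cell1] := sem_set_bricks (cost_oracle f g) 0 st loc1.
have [reg2 front2 cell2] := sem_set_brick (cost_oracle f g) 0
  (sem (Loop (set_brick true a1)) 0 st) loc2.
rewrite -/(sem start_supplies 0 (sem start_demands 0 st)) in reg2 front2 cell2 *.
move=> st'; rewrite reg2 front2 reg1 front1; split=> //.
apply/ffunP => j; apply/matrixP => i k; rewrite /st' !ffunE !mxE cell2 /= !cell1 /=.
have fr1 : front (sem (Loop (set_brick true a1)) 0 st) = instance by rewrite front1.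
have den1 (j' : 'I_n) : den n j' st (a1 (i, k)) = if i == 0%N :> nat then (c j' k)%:Z else 0.
  by rewrite /a1 /=; case: ifP => _ //=; rewrite front_st instance_demand.
rewrite ltn_ord den1; case: eqP => j0; last by rewrite addr0.
have n_gt0 : (0 < n)%N by rewrite -j0.
have den1' := den1 j; rewrite j0 in den1'.
rewrite n_gt0 den1'; congr (_ + _).
case: ifP => _ /=; first by rewrite den_other // sub0r.
by rewrite -(instance_supply s c u) -fr1.
Qed.

Lemma sem_reset_best second st : front st = instance ->
  margins s c (view true st) -> violation v u second (view true st) = 0 ->
  let st' := sem (reset_best second) 0 st in
  [/\ front st' = instance, incumbent v s c u f g second st',
      view true st' = view true st, reg st' r_best < reg st' r_old &
      forall r, (4 < r)%N -> reg st' r = reg st r].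
Proof.
move=> front_st mar_st vio_st; rewrite [sem _ _ _]/= -/(sem (copy m l true) 0 st).
have [reg1 front1 view1 view1'] := sem_copy n (cost_oracle f g) true 0 st.
move: reg1 front1 view1 view1'; rewrite [sem _ _ _]/=; set st1 := foldl _ _ _.
move=> reg1 front1 view1 view1'; rewrite front_st in front1.
have [] := sem_evaluate v f g 0 front1; rewrite [sem _ _ _]/=; set st2 := foldl _ _ _.
move=> front2 cell2 ex2 co2 reg2.
have viewE b st' : cell st' = cell st2 -> view b st' = view b st1.
  by move=> cell'; apply/ffunP => j; rewrite !ffunE cell' cell2.
have obj : den n 0 st2 (objective_term m l second) =
    objective v u f g second (view true st).
  by rewrite /objective -view1'; case: second {vio_st}.
split=> //.
- by split; rewrite viewE // view1.
- by rewrite viewE.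
- by rewrite /=; lia.
move=> r lt_r; rewrite /= gtn_eqF //= gtn_eqF ?reg2 ?reg1 //; last exact: ltnW.
by apply: leq_trans lt_r.
Qed.

Lemma sem_emit_flow st (i : 'I_m) (j : 'I_n) (k : 'I_l) :
  front (sem emit_flow 0 st) ((i * n + j) * l + k)%N = view true st j i k.
Proof.
rewrite ffunE mxE.
have idx_inj (i1 : 'I_m) (j1 : 'I_n) (k1 : 'I_l) (i2 : 'I_m) (j2 : 'I_n) (k2 : 'I_l) :
    ((i1 * n + j1) * l + k1 = (i2 * n + j2) * l + k2)%N ->
    [/\ i1 = i2, j1 = j2 & k1 = k2].
  have l_gt0 : (0 < l)%N by apply: leq_ltn_trans (ltn_ord k1).
  have n_gt0 : (0 < n)%N by apply: leq_ltn_trans (ltn_ord j1).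
  move=> eq12; have /(congr1 (divn^~ l)) := eq12; have /(congr1 (modn^~ l)) := eq12.
  rewrite !divnMDl // !modnMDl !modn_small // !divn_small // !addn0 => eq_k eq_ij.
  have /(congr1 (divn^~ n)) := eq_ij; have /(congr1 (modn^~ n)) := eq_ij.
  rewrite !divnMDl // !modnMDl !modn_small // !divn_small // !addn0 => eq_j eq_i.
  by split; apply: val_inj.
suff [_ /(_ j i k (ltn_ord j)) //] : cell (sem emit_flow 0 st) = cell st /\
  forall (j : 'I_n) (i : 'I_m) (k : 'I_l), (j < n)%N -> front (sem emit_flow 0 st)
    ((i * n + j) * l + k)%N = cell st true i k j.
apply: (loop_ind (P := fun q st' => cell st' = cell st /\
  forall (j : 'I_n) (i : 'I_m) (k : 'I_l), (j < q)%N -> front st' ((i * n + j) * l + k)%N = cell st true i k j)).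
  by [].
move=> {i k}j st' [cell' front']; rewrite sem_each.
suff: forall ps, let st1 := foldl (fun st' p =>
      sem (Emit p.1 p.2 (Cell true p.1 p.2)) j st') st' (rev ps) in
    cell st1 = cell st /\ forall (j' : 'I_n) (i : 'I_m) (k : 'I_l), (j' < j)%N || ((j' == j) && ((i, k) \in ps)) ->
      front st1 ((i * n + j') * l + k)%N = cell st true i k j'.
  move=> /(_ (rev (enum {: 'I_m * 'I_l}))); rewrite revK => -[-> front1].
  split=> // j' i k; rewrite ltnS leq_eqVlt => lt_j'; apply: front1.
  by rewrite mem_rev mem_enum andbT orbC.
elim=> [|[i0 k0] ps [cell1 front1]] /=.
  by split=> // j' i k; rewrite andbF orbF; apply: front'.
rewrite rev_cons -cats1 foldl_cat /=; split=> // j' i k in_ps.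
case: eqP => [/idx_inj[-> -> ->]|ne]; first by rewrite cell1.
apply: front1; case/orP: in_ps => [->//|/andP[/eqP def_j']].
rewrite inE => /orP[/eqP[def_i def_k]|->]; last by rewrite def_j' eqxx orbT.
by case: ne; rewrite def_i def_k def_j'.
Qed.

End Setup.

(** * The algorithm *)

Section Algorithm.
Variables (m l : nat) (v : 'I_l -> nat).
Variable HS : seq (seq 'M[int]_(m, l)).

Definition conclude (z : int) : cmd := Store (Const 0) (Const z).

(** Verdicts 0 and 1 are an optimal flow and an empty feasible set. *)
Definition algorithm : cmd :=
  Seq (comp 0 (check_balance m l))
  (If_le (comp_term 0 (Reg m l r_unbalanced)) (comp_term 0 (Lit m l 0))
    (Seq (comp 0 (prepare m v))
    (Seq (phase v HS false)
    (If_le (comp_term 0 (Reg m l r_best)) (comp_term 0 (Lit m l 0))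
      (Seq (comp 0 (reset_best m v true))
      (Seq (phase v HS true)
      (Seq (comp 0 (emit_flow m l)) (conclude 0))))
      (conclude 1))))
    (conclude 1)).

Section Instance.
Variable n : nat.
Variables (s : 'I_m -> 'I_l -> nat) (c : 'I_n -> 'I_l -> nat).
Variable u : 'I_m -> 'I_n -> nat.
Variable f : 'I_m -> 'I_n -> int -> int.
Variable g : 'I_m -> 'I_n -> 'I_l -> int -> int.
Local Notation O := (cost_oracle f g).
Local Notation sem := (sem n O).
Local Notation instance := (instance s c u).

Definition start_excess : nat := `|excess v u (start s c)|%N.
Definition flow_bound : nat := (total_supply s + m.+1 * start_excess)%N.

Lemma sem_prepare st : front st = instance -> commodity_balance s c ->
  let st' := sem (prepare m v) 0 st in
  [/\ front st' = instance, incumbent v s c u f g false st',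
      reg st' r_best < reg st' r_old, reg st' r_bound = flow_bound%:Z
    & reg st' r_best = start_excess%:Z].
Proof.
move=> front_st bal.
pose st2 := sem (start_supplies m l) 0 (sem (start_demands m l) 0 st).
have [front2 reg2 view2] : [/\ front st2 = instance, reg st2 = reg st & view n true st2 = start s c].
  exact: sem_start.
have mar2 : margins s c (view n true st2) by rewrite view2; apply: margins_start.
pose st3 := sem (reset_best m v false) 0 st2.
have [front3 inc3 view3 old3 _] : [/\ front st3 = instance,
    incumbent v s c u f g false st3, view n true st3 = view n true st2,
    reg st3 r_best < reg st3 r_old & forall r, (4 < r)%N -> reg st3 r = reg st2 r].
  exact: sem_reset_best.
have best3 : reg st3 r_best = start_excess%:Z.
  have [_ _ ->] := inc3; rewrite view3 view2 /objective /start_excess.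
  by rewrite gez0_abs ?excess_ge0.
rewrite -[sem (prepare m v) 0 st]/(sem (set_bound m l) 0 st3); split=> //.
rewrite -[LHS]/(den n 0 st3 (plus_all (enum 'I_m)
    (fun i => plus_all (enum 'I_l) (Supply i))) +
  den n 0 st3 (scale m.+1 (Reg m l r_best))).
rewrite den_plus_all den_scale -[den n 0 st3 (Reg m l r_best)]/(reg st3 r_best) best3 /flow_bound PoszD PoszM; congr (_ + _).
rewrite /total_supply -[RHS]natz natr_sum big_enum; apply: eq_bigr => i _.
rewrite den_plus_all natr_sum big_enum; apply: eq_bigr => k _.
by rewrite /= front3 instance_supply natz.
Qed.

End Instance.
End Algorithm.

Section Sizes.
Local Open Scope nat_scope.

Lemma muln_lt_expn a b p q : a < 2 ^ p -> b < 2 ^ q -> a * b < 2 ^ (p + q).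
Proof. by move=> lt_a lt_b; rewrite expnD ltn_mul. Qed.

(** The bound is a product of a constant, of [n] and of the total of supplies and
    demands, up to another such total. *)
Lemma bits_flow_bound m n l (v : 'I_l -> nat) (s : 'I_m -> 'I_l -> nat)
    (c : 'I_n -> 'I_l -> nat) (u : 'I_m -> 'I_n -> nat) :
  bits (flow_bound v s c u) <=
    bits (m.+1 * m * (\sum_k v k + l)) + 2 * (n + data_bits s c u).
Proof.
set w := m.+1 * m * _; set db := data_bits s c u.
have lt_B : total_demand c + total_supply s < 2 ^ db := total_lt_data_bits s c u.
have le_E : start_excess v s c u <=
    m * (n * ((\sum_k v k + l) * (total_demand c + total_supply s))).
  rewrite /start_excess -lez_nat gez0_abs ?excess_ge0 //.
  by apply: excess_le => j i k; apply: start_bounded.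
have lt_prod : w * n * (total_demand c + total_supply s) < 2 ^ (bits w + n + db).
  by apply: muln_lt_expn lt_B; apply: muln_lt_expn; [apply: ltn_bits | apply: ltn_expl].
apply: bits_le; first by rewrite addn_gt0.
have -> : bits w + 2 * (n + db) = (bits w + n + db) + (n + db) by lia.
apply: leq_ltn_trans (addn_lt_expn lt_prod (leq_trans lt_B (leq_pexp2l _ (leq_addl _ _)))) => //.
rewrite /flow_bound addnC; apply: leq_add; last exact: leq_addl.
have := leq_mul (leqnn m.+1) le_E; rewrite /w.
by move: (start_excess _ _ _ _) (\sum_k v k + l) (total_demand c + total_supply s) => a b d; lia.
Qed.

End Sizes.

(** * Correctness and running time *)

Lemma exists_minimizer (T : Type) (P : T -> Prop) (F : T -> int) (lo : int) x0 :
  P x0 -> (forall x, P x -> lo <= F x) -> exists2 y, P y & forall x, P x -> F y <= F x.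
Proof.
move=> Px0 lo_F; pose Q k := `[< exists2 x, P x & `|F x - lo|%N = k >].
have [|k /asboolP[y Py def_k] min_k] := @ex_minnP Q.
  by exists `|F x0 - lo|%N; apply/asboolP; exists x0.
exists y => // x Px; have : Q `|F x - lo|%N by apply/asboolP; exists x.
by move/min_k; rewrite -def_k; have := lo_F x Px; have := lo_F y Py; lia.
Qed.

Section Main.
Variables (m l : nat) (v : 'I_l -> nat).
Variable HS : seq (seq 'M[int]_(m, l)).
Hypothesis HS_balanced : forall hs, hs \in HS -> \sum_(h <- hs) h = 0 /\
  forall h : 'M[int]_(m, l), h \in hs -> forall k, \sum_i h i k = 0.
Hypothesis HS_dominates : forall n (d : bricks m n l), balanced d -> d != 0 ->
  exists2 hs, hs \in HS & exists2 g, g \in places n hs & (g != 0) && below v g d.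

(** Bounds [n] and the binary lengths of [flow_bound] and of the gaps to be
    closed in both phases. *)
Definition scale_of (size : nat) : nat :=
  (bits (m.+1 * m * (\sum_k v k + l)) + 2 * size)%N.

Lemma abs_cost_le n s c u (f : 'I_m -> 'I_n -> int -> int) g x :
  feasible v s c u x -> (`|cost v f g x| <=
    max_abs (feasible v s c u) (fcost v f) + max_abs (feasible v s c u) (gcost g))%N.
Proof.
move=> feas_x; rewrite costE.
have := max_abs_feasible (fcost v f) feas_x; have := max_abs_feasible (gcost g) feas_x.
by move: (max_abs _ _) (max_abs _ _) (fcost _ _ _) (gcost _ _) => a b y z; lia.
Qed.

Lemma run_algorithm : exists T, poly_bounded T /\ forall n
    (s : 'I_m -> 'I_l -> nat) (c : 'I_n -> 'I_l -> nat) (u : 'I_m -> 'I_n -> nat)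
    (f : 'I_m -> 'I_n -> int -> int) (g : 'I_m -> 'I_n -> 'I_l -> int -> int),
  (forall i j, convex_int (f i j)) -> (forall i j k, convex_int (g i j k)) ->
  exists M t, [/\ exec (cost_oracle f g) (algorithm v HS) (initial_memory s c u) M t,
    solves (feasible v s c u) (cost v f g) (output m n l M)
    & (t <= T (scale_of (n + data_bits s c u
        + bits (max_abs (feasible v s c u) (fcost v f))
        + bits (max_abs (feasible v s c u) (gcost g)))))%N].
Proof.
have [T1 [polyT1 run1]] := run_phase false HS_balanced HS_dominates.
have [T2 [polyT2 run2]] := run_phase true HS_balanced HS_dominates.
have [a1 [e1 run_check]] := comp_correct 0 (check_balance m l).
have [a2 [e2 run_prepare]] := comp_correct 0 (prepare m v).
have [a3 [e3 run_reset]] := comp_correct 0 (reset_best m v true).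
have [a4 [e4 run_emit]] := comp_correct 0 (emit_flow m l).
pose E a e z := (a * z.+1 ^ e)%N.
have polyE a e : poly_bounded (E a e).
  apply: poly_muln (poly_const _) (poly_expn _ _).
  by have := poly_addn (poly_const 1) poly_id.
exists (fun z => E a1 e1 z + (4 + (E a2 e2 z + (T1 z + (4 + (E a3 e3 z +
  (T2 z + (E a4 e4 z + 3))))))))%N; split.
  by do ?[exact: poly_const|exact: polyE|exact: polyT1|exact: polyT2|apply: poly_addn].
move=> n s c u f g cvx_f cvx_g.
set fhat := max_abs _ (fcost _ _); set ghat := max_abs _ (gcost _).
set z := scale_of _; pose O := cost_oracle f g.
have le_nz : (n <= z)%N by rewrite /z /scale_of; lia.
have le_E t a e : (t <= a * n.+1 ^ e)%N -> (t <= E a e z)%N.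
  by move/leq_trans; apply; rewrite leq_mul2l leq_pow ?orbT.
have le_bound : (bits (flow_bound v s c u) <= z)%N.
  apply: leq_trans (bits_flow_bound v s c u) _.
  by rewrite /z /scale_of leq_add2l leq_mul2l -addnA leq_addr.
have empty_out M : (forall X, margins s c X -> excess v u X = 0 -> False) ->
    solves (feasible v s c u) (cost v f g) (output m n l (update M 0 1)).
  move=> empty; rewrite /output /update eqxx /=; apply/seteqP; split=> // x.
  by have [X ->] := flow_ofE x; case/feasible_flow_of => /empty.
have run_conclude M w : exec O (conclude w) M (update M 0 w) 3 by apply: ExecStore.
pose st0 := State (fun=> 0) (fun _ _ _ _ => 0) (instance s c u) : state m l.
have rep0 : rep n 0 0 (initial_memory s c u) st0.
  split=> // [r|b i k j']; first by rewrite /reg_addr addn1.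
  by rewrite /cell_addr addn3.
have [M1 [t1 [ex1 rep1 _ /le_E le1]]] := run_check n O 0%N _ st0 rep0.
have [front1 bal1] : front (sem n O (check_balance m l) 0 st0) = instance s c u /\
    (reg (sem n O (check_balance m l) 0 st0) r_unbalanced <= 0 <-> commodity_balance s c).
  exact: sem_check_balance.
move: rep1 front1 bal1; set st1 := sem _ _ _ _ _ => rep1 front1 bal1.
case: (leP (reg st1 r_unbalanced) 0) => [/bal1 bal|unb]; last first.
  exists (update M1 0 1), (t1 + 7)%N; split; last by lia.
    apply: ExecSeq ex1 _; apply: (@ExecIfFalse O _ _ _ _ _ _ 3) => //.
    by rewrite !(eval_comp_term _ rep1).
  apply: empty_out => X /margins_commodity_balance/bal1.
  by rewrite leNgt unb.
have unb1 : reg st1 r_unbalanced <= 0 by apply/bal1.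
have [M2 [t2 [ex2 rep2 _ /le_E le2]]] := run_prepare n O 0%N _ st1 rep1.
have [] : [/\ front (sem n O (prepare m v) 0 st1) = instance s c u,
    incumbent v s c u f g false (sem n O (prepare m v) 0 st1),
    reg (sem n O (prepare m v) 0 st1) r_best < reg (sem n O (prepare m v) 0 st1) r_old,
    reg (sem n O (prepare m v) 0 st1) r_bound = (flow_bound v s c u)%:Z
    & reg (sem n O (prepare m v) 0 st1) r_best = (start_excess v s c u)%:Z].
  exact: sem_prepare.
move: rep2; set st2 := sem _ _ _ _ _ => rep2 front2 inc2 old2 bound2 best2.
have start_E : excess v u (start s c) = (start_excess v s c u)%:Z.
  by rewrite /start_excess gez0_abs ?excess_ge0.
have [y1 mar_y1 min_y1] := exists_minimizer (F := excess v u) (lo := 0)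
  (margins_start bal) (fun x _ => excess_ge0 v u x).
have y1_start : excess v u y1 <= (start_excess v s c u)%:Z.
  by rewrite -start_E; apply/min_y1/margins_start.
have [||||||M3 [t3 [st3 [ex3 rep3 [front3 inc3] [bound3 best3] le3]]]] :=
    run1 n s c u f g M2 st2 (flow_bound v s c u) y1 z cvx_f cvx_g rep2 front2 inc2 old2
    bound2 mar_y1.
- by [].
- by move=> x mar_x _; apply: min_y1.
- move=> x mar_x _ le_x; apply: margins_bounded bal mar_x mar_y1 _ y1_start.
  by rewrite -best2.
- by [].
- by [].
- apply: leq_trans le_bound; apply: leq_bits; rewrite best2 /= /flow_bound mulSn.
  have := excess_ge0 v u y1; move: (excess v u y1) y1_start => e0.
  by move: (start_excess _ _ _ _) (total_supply _) (m * _)%N => a b d; lia.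
have {}ex3 M' t' : exec O (If_le (comp_term 0 (Reg m l r_best)) (comp_term 0 (Lit m l 0))
      (Seq (comp 0 (reset_best m v true)) (Seq (phase v HS true)
      (Seq (comp 0 (emit_flow m l)) (conclude 0)))) (conclude 1)) M3 M' t' ->
    exec O (algorithm v HS) (initial_memory s c u) M' (t1 + (4 + (t2 + (t3 + t')))).
  move=> ex; apply: ExecSeq ex1 _.
  apply: (@ExecIfTrue O (comp_term 0 (Reg m l r_unbalanced)) (comp_term 0 (Lit m l 0))).
    by rewrite !(eval_comp_term _ rep1).
  by apply: ExecSeq ex2 _; apply: ExecSeq ex3 ex.
case: (leP (reg st3 r_best) 0) => [le_best|gt_best]; last first.
  exists (update M3 0 1), (t1 + (4 + (t2 + (t3 + 7))))%N; split; last by lia.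
    apply: ex3; apply: (@ExecIfFalse O _ _ _ _ _ _ 3) => //.
    by rewrite !(eval_comp_term _ rep3).
  apply: empty_out => X mar_X X0; move: gt_best; rewrite best3 ltNge.
  by rewrite -[X in _ <= X]X0 min_y1.
have [mar3 _ obj3] := inc3.
have exc3 : excess v u (view n true st3) = 0.
  apply/eqP; rewrite eq_le excess_ge0 andbT.
  by move: obj3; rewrite /objective => <-.
have [M4 [t4 [ex4 rep4 _ /le_E le4]]] := run_reset n O 0%N _ st3 rep3.
have [] : [/\ front (sem n O (reset_best m v true) 0 st3) = instance s c u,
    incumbent v s c u f g true (sem n O (reset_best m v true) 0 st3),
    view n true (sem n O (reset_best m v true) 0 st3) = view n true st3,
    reg (sem n O (reset_best m v true) 0 st3) r_best <
      reg (sem n O (reset_best m v true) 0 st3) r_old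
    & forall r, (4 < r)%N -> reg (sem n O (reset_best m v true) 0 st3) r = reg st3 r].
  exact: sem_reset_best.
move: rep4; set st4 := sem _ _ _ _ _ => rep4 front4 inc4 view4 old4 reg4.
have cost_lo X : margins s c X /\ excess v u X = 0 ->
    (`|cost v f g (flow_of X)| <= fhat + ghat)%N.
  by move=> feas_X; apply/abs_cost_le/feasible_flow_of.
have [y2 [mar_y2 exc_y2] min_y2] := exists_minimizer
  (P := fun X => margins s c X /\ excess v u X = 0) (F := fun X => cost v f g (flow_of X))
  (lo := - (fhat + ghat)%N%:Z) (conj mar3 exc3)
  (fun X feas_X => ltac:(have := cost_lo X feas_X; lia)).
have [|||||M5 [t5 [st5 [ex5 rep5 [front5 inc5] [bound5 best5] le5]]]] :=
    run2 n s c u f g M4 st4 (flow_bound v s c u) y2 z cvx_f cvx_g rep4 front4 inc4 old4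
    _ mar_y2 exc_y2 (fun x mar_x exc_x => min_y2 x (conj mar_x exc_x)).
- by rewrite reg4.
- move=> x mar_x exc_x _; apply: (margins_bounded (u := u) (v := v) bal mar_x mar_y2).
    by rewrite (exc_x : excess v u x = 0).
  by rewrite exc_y2.
- by [].
- by [].
- have [_ _ ->] := inc4; rewrite view4 /objective.
  have := cost_lo _ (conj mar3 exc3); have := cost_lo _ (conj mar_y2 exc_y2).
  move: (cost _ _ _ _) (cost _ _ _ _) => b a le_b le_a.
  have lt_hat : (fhat + ghat < 2 ^ (bits fhat + bits ghat))%N.
    by apply: addn_lt_expn; apply: ltn_bits.
  apply: (@leq_trans ((bits fhat + bits ghat) + (bits fhat + bits ghat))).
    apply: bits_le; first by rewrite !addn_gt0.
    by apply: leq_ltn_trans (addn_lt_expn lt_hat lt_hat); lia.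
  by rewrite /z /scale_of; lia.
have [M6 [t6 [ex6 rep6 _ /le_E le6]]] := run_emit n O 0%N _ st5 rep5.
exists (update M6 0 0), (t1 + (4 + (t2 + (t3 + (4 + (t4 + (t5 + (t6 + 3))))))))%N.
split; last by lia.
  apply: ex3.
  apply: (@ExecIfTrue O (comp_term 0 (Reg m l r_best)) (comp_term 0 (Lit m l 0))).
    by rewrite !(eval_comp_term _ rep3).
  by apply: ExecSeq ex4 _; apply: ExecSeq ex5 _; apply: ExecSeq ex6 _.
rewrite /output (_ : update M6 0 0 0 = 0) ?eqxx; last by rewrite /update eqxx.
have -> : (fun (i : 'I_m) (j : 'I_n) (k : 'I_l) =>
    update M6 0 0 ((i * n + j) * l + k).+1%N%:Z) = flow_of (view n true st5).
  apply: funext => i; apply: funext => j; apply: funext => k.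
  by rewrite /update /= (rep_front rep6) sem_emit_flow.
have [mar5 exc5 obj5] := inc5; split; first by apply/feasible_flow_of.
move=> x; have [X ->] := flow_ofE x => /feasible_flow_of feas_X.
by have := min_y2 X feas_X; move: obj5; rewrite best5 /objective => <-.
Qed.

End Main.

Local Close Scope ring_scope.

Theorem theorem2p8 (l m : nat) (v : 'I_l -> nat) :
  exists (P : cmd) (a d : nat),
  forall (n : nat)
    (s : 'I_m -> 'I_l -> nat) (c : 'I_n -> 'I_l -> nat) (u : 'I_m -> 'I_n -> nat)
    (f : 'I_m -> 'I_n -> int -> int) (g : 'I_m -> 'I_n -> 'I_l -> int -> int),
    (forall i j, convex_int (f i j)) ->
    (forall i j k, convex_int (g i j k)) ->
    exists (M : memory) (t : nat),
      [/\ exec (cost_oracle f g) P (initial_memory s c u) M t,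
          solves (feasible v s c u) (cost v f g) (output m n l M)
        & t <= a * (n + data_bits s c u
                    + bits (max_abs (feasible v s c u) (fcost v f))
                    + bits (max_abs (feasible v s c u) (gcost g))) ^ d].
Proof.
have [HS [HS_bal HS_dom]] := small_moves m v.
have [T [[a [d polyT]] run]] := run_algorithm HS_bal HS_dom.
pose K := (bits (m.+1 * m * (\sum_k v k + l)) + 3)%N.
exists (algorithm v HS), (a * K ^ d)%N, d => n s c u f g cvx_f cvx_g.
have [M [t [ex sol le_t]]] := run n s c u f g cvx_f cvx_g.
exists M, t; split=> //; apply: leq_trans le_t (leq_trans (polyT _) _).
rewrite -mulnA leq_mul2l -expnMn leq_pow ?orbT // /scale_of /K.
have : (0 < bits (max_abs (feasible v s c u) (fcost v f)))%N by [].
move: (bits (max_abs _ (fcost _ _))) (bits (max_abs _ (gcost _))) => p q.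
by move: (bits _) (data_bits _ _ _) => w e; nia.
Qed.
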